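(* Let $G$ be a finitely generated group with finite generating set $S$ acting geometrically finitely on $\Lambda G$, and let $o\in G$. For any $l\ge0$ there exists $0<\lambda_0<1$ such that for any $\lambda\in[\lambda_0,1)$ the following holds. For any $\xi\ne\eta\in\Lambda G$ there exists a sequence of generalized $(1,l)$-tight paths $\gamma_n$ with $(\gamma_n)_-\in[o,\xi]$ and $(\gamma_n)_+\in[o,\eta]$ such that $$\lim_{n\to\infty}d(o,(\gamma_n)_-)=\lim_{n\to\infty}d(o,(\gamma_n)_+)=\infty\qquad\text{and}\qquad\lim_{n\to\infty}\mathfrak l_{\lambda,o}(\gamma_n)=\bar\rho_{\lambda,o}(\xi,\eta).$$ Here $[o,\xi]$ and $[o,\eta]$ are word-geodesic rays from $o$ ending at $\xi$ and $\eta$.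
   Context: Convergence actions. All actions $G\curvearrowright X$ are convergence actions on compact metrizable spaces (properly discontinuous on distinct triples). The action is minimal if $X$ equals the limit set (set of accumulation points of orbits). $\xi\in X$ is conical if there are pairwise distinct $g_n\in G$ such that for every $\eta\in X\setminus\{\xi\}$ the closure of $\{(g_n\xi,g_n\eta):n\ge1\}$ in $X^2$ is disjoint from the diagonal. $\xi$ is bounded parabolic if its stabilizer (then called maximal parabolic) is infinite and acts properly and cocompactly on $X\setminus\{\xi\}$. The action is geometrically finite if it is minimal, without global fixed point, and every point is conical or bounded parabolic; then $X=\Lambda G$. Floyd and shortcut metrics. $1\notin S=S^{-1}$, $d=d_S$ is the word metric on the Cayley graph $\mathscr G(G,S)$. Give each edge $e$ the Floyd length $\lambda^{d(o,e)}$; the Floyd length $\mathfrak l_{\lambda,o}(\gamma)$ of a path is the sum over its edges (and for a finite sequence of paths, the sum of the lengths of its members). The Floyd metric $\rho_{\lambda,o}$ is the induced length metric, $\overline G_\lambda$ the Cauchy completion, $\partial_\lambda G=\overline G_\lambda\setminus\mathscr G(G,S)$. There is $\lambda_1\in(0,1)$ such that for all $\lambda\in[\lambda_1,1)$ (always assumed) there is a continuous equivariant surjection $F_\lambda:\partial_\lambda G\to\Lambda G$ (Floyd map), extended by the identity on $\mathscr G(G,S)$. Let $\omega=\{(\xi,\eta)\in\partial_\lambda G\times\partial_\lambda G:F_\lambda(\xi)=F_\lambda(\eta)\}$ and $\tilde\rho_{\lambda,o}(\xi,\eta)=\inf\sum_{i=1}^n\rho_{\lambda,o}(\xi_i,\eta_i)$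 over all $n\ge1$ and chains with $\xi_1=\xi,\eta_n=\eta$, $(\eta_i,\xi_{i+1})\in\omega$ for $1\le i<n$. The shortcut metric on $\Lambda G\sqcup\mathscr G(G,S)$ is $\bar\rho_{\lambda,o}(x,y)=\tilde\rho_{\lambda,o}(F_\lambda^{-1}(x),F_\lambda^{-1}(y))$, a well-defined metric. Word-geodesic rays converge in $\overline G_\lambda$ to points of $\partial_\lambda G$; a ray ends at $\xi\in\Lambda G$ if its endpoint in $\partial_\lambda G$ lies in $F_\lambda^{-1}(\xi)$. Horospheres. $\mathbb P=\{gP\}$ is the set of left cosets of a set of conjugacy representatives $P$ of the maximal parabolic subgroups; $N_\varepsilon(X)$ is the closed $\varepsilon$-neighbourhood in the word metric. For a path $\gamma$ and vertex $v\in\gamma$: $v$ is $(\varepsilon,R)$-deep in $X\in\mathbb P$ if $\gamma\cap B(v,R)\subset N_\varepsilon(X)$, and an $(\varepsilon,R)$-transition point if it is not $(\varepsilon,R)$-deep in any $X\in\mathbb P$. The constant $\varepsilon$. There are $\mu_1,D_1>0$ with $\operatorname{diam}\mathbf{Proj}_X(\gamma)<D_1$ (nearest-point projection) for all $X\in\mathbb P$ and geodesics $\gamma$ with $\gamma\cap N_{\mu_1}(X)=\emptyset$. The constant $\varepsilon$ (for $c=1$) is fixed with: (a) $\varepsilon>\mu_1$; (b) for every $R>0$ and $\lambda\in[\lambda_1,1)$ there is $\kappa>0$ with $\bar\rho_{\lambda,v}(\gamma_-,\gamma_+)>\kappa$ for every geodesic $\gamma$ and $(\varepsilon,R)$-transition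 point $v$ of $\gamma$; (c) for all $\varepsilon'\ge\varepsilon$, $R'\ge0$ there is $L'>0$ such that if $\gamma$ is a geodesic and $X\in\mathbb P$ with $d(\gamma_\pm,X)<\varepsilon'$, then every $z\in\gamma$ with $d(z,\gamma_\pm)>L'$ is $(\varepsilon,R')$-deep in $X$. Tight paths. A path $\alpha$ is a $c$-quasi-geodesic ($c\ge1$) if $\ell(\beta)\le c\,d(\beta_-,\beta_+)+c$ for every subpath $\beta$ of $\alpha$, where $\beta_\pm$ are the endpoints and $\ell$ is word length. A path $\gamma$ in $\mathscr G(G,S)$ is $(c,l)$-tight if for any $x,y\in\gamma$ with $d(x,y)\le l$ the subpath $[x,y]_\gamma$ is a $c$-quasi-geodesic. A generalized $(c,l)$-tight path $\gamma$ is a finite sequence of $(c,l)$-tight paths $\gamma_1,\dots,\gamma_m$ ($m\ge1$) in $\mathscr G(G,S)$ such that for $1\le i<m$ there are pairwise distinct $X_i\in\mathbb P$ with $(\gamma_i)_+,(\gamma_{i+1})_-\in N_\varepsilon(X_i)$, and such that, if $y_i$ is the entry (first) point of $\gamma_i$ in $N_\varepsilon(X_i)$ and $x_{i+1}$ is the exit (last) point of $\gamma_{i+1}$ in $N_\varepsilon(X_i)$, then $d(y_i,x_{i+1})\ge l$ for $1\le i<m$. Its endpoints are $\gamma_-=(\gamma_1)_-$ and $\gamma_+=(\gamma_m)_+$. *)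

(* Defs.v *)
From HB Require Import structures.
From mathcomp Require Import all_boot all_order all_algebra.
From mathcomp Require Import finmap.
From mathcomp Require Import all_classical all_reals all_analysis.

Set Implicit Arguments.
Unset Strict Implicit.
Unset Printing Implicit Defensive.

Import Order.TTheory GRing.Theory Num.Theory.
Import numFieldNormedType.Exports.

Local Open Scope classical_set_scope.
Local Open Scope ring_scope.

Section ConvergenceActions.
Variables (R : realType) (G : groupType) (X : metricType R).
Variable act : G -> X -> X.

Definition action_by_homeomorphisms : Prop :=
  [/\ forall x, act 1%g x = x,
      forall g h x, act (g * h)%g x = act g (act h x)
    & forall g, continuous (act g)].

Definition distinct_triples : set (X * X * X) :=
  [set t | [/\ t.1.1 <> t.1.2, t.1.1 <> t.2 & t.1.2 <> t.2]].

Definition act3 (g : G) (t : X * X * X) : X * X * X :=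
  (act g t.1.1, act g t.1.2, act g t.2).

(* Convergence action on a compact metrizable space. The metric carried by
   [X] only serves to express metrizability of its topology. *)
Definition convergence_action : Prop :=
  [/\ compact [set: X], action_by_homeomorphisms
    & forall K : set (X * X * X), compact K -> K `<=` distinct_triples ->
        finite_set [set g | (act3 g @` K) `&` K !=set0]].

(* Accumulation points of the orbit maps [g |-> act g y]: group elements are
   counted, not points of the orbit, so that the limit set of a two-ended
   group consists of two points. *)
Definition limit_set : set X :=
  [set z | exists y, forall U, nbhs z U -> infinite_set [set g | U (act g y)]].

Definition minimal_action : Prop := limit_set = [set: X].

Definition conical (xi : X) : Prop :=
  exists g : nat -> G, injective g /\
    forall eta, eta <> xi ->
      closure (range (fun n => (act (g n) xi, act (g n) eta)))
        `&` [set p : X * X | p.1 = p.2] = set0.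

Definition stabilizer (xi : X) : set G := [set g | act g xi = xi].

Definition bounded_parabolic (xi : X) : Prop :=
  [/\ infinite_set (stabilizer xi),
      forall K : set X, compact K -> K `<=` [set~ xi] ->
        finite_set (stabilizer xi `&` [set g | (act g @` K) `&` K !=set0])
    & exists K : set X, [/\ compact K, K `<=` [set~ xi]
        & forall x, x <> xi -> exists2 g, stabilizer xi g & (act g @` K) x]].

Definition geometrically_finite : Prop :=
  [/\ convergence_action, minimal_action,
      ~ (exists x, forall g, act g x = x)
    & forall xi, conical xi \/ bounded_parabolic xi].

(* [Par] contains exactly one representative of each conjugacy class of
   maximal parabolic subgroups. *)
Definition parabolic_representatives (Par : set (set G)) : Prop :=
  (forall P, Par P -> exists2 xi, bounded_parabolic xi & P = stabilizer xi) /\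
  (forall xi, bounded_parabolic xi ->
     exists! P, Par P /\
       exists g, stabilizer xi = (fun p => g * p * g^-1)%g @` P).

End ConvergenceActions.

Definition parabolic_cosets (G : groupType) (Par : set (set G)) :
    set (set G) :=
  [set Y | exists g P, Par P /\ Y = (fun p => g * p)%g @` P].

Section CayleyGraph.
Variables (R : realType) (G : groupType) (S : {fset G}).

Definition symmetric_generating_set : Prop :=
  [/\ 1%g \notin S, forall s, s \in S -> (s^-1)%g \in S
    & forall g : G, exists2 w : seq G,
        {subset w <= S} & g = (\prod_(s <- w) s)%g].

Definition cayley : rel G := fun x y => (x^-1 * y)%g \in S.

(* The pair [(x, s)] stands for the sequence of vertices [x :: s]. *)
Definition epath : Type := (G * seq G)%type.

Definition is_path (p : epath) : bool := path cayley p.1 p.2.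
Definition vertices (p : epath) : seq G := p.1 :: p.2.
Definition source (p : epath) : G := p.1.
Definition target (p : epath) : G := last p.1 p.2.
Definition word_length (p : epath) : nat := size p.2.
Definition vertex (p : epath) (i : nat) : G := nth p.1 (vertices p) i.

(* For [i <= j <= word_length p], the part of [p] from its [i]-th to its
   [j]-th vertex. *)
Definition subpath (p : epath) (i j : nat) : epath :=
  (vertex p i, take (j - i) (drop i p.2)).

Definition path_between (x y : G) : set epath :=
  [set p | [/\ is_path p, source p = x & target p = y]].

Definition word_dist (x y : G) : nat :=
  get [set n | (exists2 p, path_between x y p & word_length p = n) /\
               (forall p, path_between x y p -> (n <= word_length p)%N)].

Definition geodesic (p : epath) : Prop :=
  is_path p /\ word_length p = word_dist (source p) (target p).

Definition geodesic_ray (o : G) (a : nat -> G) : Prop :=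
  a 0%N = o /\
  forall i j, (i <= j)%N -> word_dist (a i) (a j) = (j - i)%N.

(* Closed neighbourhood; the word metric is integer-valued, so the distance to
   a nonempty set is attained. *)
Definition nbhd (eps : R) (Y : set G) : set G :=
  [set g | exists2 x, Y x & (word_dist g x)%:R <= eps].

Definition nearest_points (Y : set G) (p : epath) : set G :=
  [set x | Y x /\ exists2 y, y \in vertices p &
     forall x', Y x' -> (word_dist y x <= word_dist y x')%N].

Definition deep (eps r : R) (Y : set G) (p : epath) (v : G) : Prop :=
  forall w, w \in vertices p -> (word_dist v w)%:R <= r -> nbhd eps Y w.

Definition transition_point (PP : set (set G)) (eps r : R) (p : epath)
    (v : G) : Prop :=
  v \in vertices p /\ forall Y, PP Y -> ~ deep eps r Y p v.

Definition quasi_geodesic (c : R) (p : epath) : Prop :=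
  is_path p /\
  forall i j, (i <= j)%N -> (j <= word_length p)%N ->
    (word_length (subpath p i j))%:R <=
      c * (word_dist (source (subpath p i j)) (target (subpath p i j)))%:R + c.

(* A vertex visited several times by [p] gives several choices of indices. *)
Definition tight (c l : R) (p : epath) : Prop :=
  is_path p /\
  forall i j, (i <= j)%N -> (j <= word_length p)%N ->
    (word_dist (vertex p i) (vertex p j))%:R <= l ->
    quasi_geodesic c (subpath p i j).

(* These are relevant only when some vertex of [p] lies in [A]. *)
Definition entry_point (A : set G) (p : epath) : G :=
  vertex p (find (fun x => `[< A x >]) (vertices p)).
Definition exit_point (A : set G) (p : epath) : G :=
  nth (source p) (rev (vertices p))
    (find (fun x => `[< A x >]) (rev (vertices p))).

Definition path_nth (gam : seq epath) (i : nat) : epath :=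
  nth (1%g, [::]) gam i.

Definition generalized_tight (PP : set (set G)) (eps c l : R)
    (gam : seq epath) : Prop :=
  [/\ (0 < size gam)%N,
      forall p, p \in gam -> tight c l p
    & exists Y : nat -> set G,
      [/\ forall i, (i.+1 < size gam)%N -> PP (Y i),
          forall i j, (i.+1 < size gam)%N -> (j.+1 < size gam)%N ->
            Y i = Y j -> i = j
        & forall i, (i.+1 < size gam)%N ->
          [/\ nbhd eps (Y i) (target (path_nth gam i)),
              nbhd eps (Y i) (source (path_nth gam i.+1))
            & l <= (word_dist
                     (entry_point (nbhd eps (Y i)) (path_nth gam i))
                     (exit_point (nbhd eps (Y i)) (path_nth gam i.+1)))%:R]]].

Definition gen_source (gam : seq epath) : G := source (path_nth gam 0).
Definition gen_target (gam : seq epath) : G :=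
  target (path_nth gam (size gam).-1).

(* All distances are integers: a bound on all pairs bounds the diameter
   strictly. *)
Definition projection_bound (PP : set (set G)) (mu1 D1 : R) : Prop :=
  forall (Y : set G) (p : epath), PP Y -> geodesic p ->
    (forall v, v \in vertices p -> ~ nbhd mu1 Y v) ->
    forall x x', nearest_points Y p x -> nearest_points Y p x' ->
      (word_dist x x')%:R < D1.

Definition deepness_bound (PP : set (set G)) (eps : R) : Prop :=
  forall eps' r : R, eps <= eps' -> 0 <= r ->
    exists2 L : R, 0 < L &
      forall (Y : set G) (p : epath), PP Y -> geodesic p ->
        (exists2 x, Y x & (word_dist (source p) x)%:R < eps') ->
        (exists2 x, Y x & (word_dist (target p) x)%:R < eps') ->
        forall z, z \in vertices p ->
          L < (word_dist z (source p))%:R -> L < (word_dist z (target p))%:R ->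
          deep eps r Y p z.

End CayleyGraph.

Section Floyd.
Variables (R : realType) (G : groupType) (S : {fset G}).

Definition edge_dist (o : G) (e : G * G) : nat :=
  minn (word_dist S o e.1) (word_dist S o e.2).

Definition floyd_length (lam : R) (o : G) (p : epath G) : R :=
  \sum_(e <- zip (vertices p) p.2) lam ^+ edge_dist o e.

Definition gen_floyd_length (lam : R) (o : G) (gam : seq (epath G)) : R :=
  \sum_(p <- gam) floyd_length lam o p.

Definition floyd_dist (lam : R) (o x y : G) : R :=
  inf (floyd_length lam o @` path_between S x y).

(* The Floyd completion is taken of the vertex set: edges are attached to
   vertices and become short far from [o], so interior points of edges create
   no further boundary point. The metrics for different base points are
   bi-Lipschitz equivalent, so Cauchy sequences and their equivalence do not
   depend on the base point, here [1]. *)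
Definition floyd_cauchy (lam : R) (u : nat -> G) : Prop :=
  forall e : R, 0 < e -> exists N : nat, forall m n : nat,
    (N <= m)%N -> (N <= n)%N -> floyd_dist lam 1%g (u m) (u n) < e.

Definition floyd_close (lam : R) (u v : nat -> G) : Prop :=
  floyd_dist lam 1%g (u n) (v n) @[n --> \oo] --> (0 : R).

Definition floyd_class (lam : R) (u : nat -> G) : set (nat -> G) :=
  [set v | floyd_cauchy lam v /\ floyd_close lam u v].

(* Points of the completion that are not vertices, as equivalence classes of
   Cauchy sequences. *)
Definition floyd_boundary (lam : R) : Type :=
  {A : set (nat -> G) | exists u, [/\ floyd_cauchy lam u,
     forall g : G, ~ floyd_close lam u (fun=> g) & A = floyd_class lam u]}.

Definition floyd_completion (lam : R) : Type := (G + floyd_boundary lam)%type.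

Definition approx (lam : R) (x : floyd_completion lam) : nat -> G :=
  match x with
  | inl g => fun=> g
  | inr z => sval (cid (svalP z))
  end.

Definition floyd_cdist (lam : R) (o : G) (x y : floyd_completion lam) : R :=
  lim (floyd_dist lam o (approx x n) (approx y n) @[n --> \oo]).

Section FloydMap.
Variables (X : metricType R) (act : G -> X -> X).

Definition floyd_map (lam : R) (F : floyd_boundary lam -> X) : Prop :=
  [/\ forall (z : floyd_boundary lam) (U : set X), nbhs (F z) U ->
        exists2 e : R, 0 < e & forall z' : floyd_boundary lam,
          floyd_cdist 1%g (inr z) (inr z') < e -> U (F z'),
      forall (g : G) (z z' : floyd_boundary lam),
        (exists2 u, sval z u & sval z' (fun n => g * u n)%g) ->
        F z' = act g (F z)
    & forall x, exists z, F z = x].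

Variables (lam : R) (F : floyd_boundary lam -> X).

(* In the disjoint union of the group (first) and of [X]. *)
Definition floyd_map_ext (x : floyd_completion lam) : G + X :=
  match x with inl g => inl g | inr z => inr (F z) end.

Definition omega (x y : floyd_completion lam) : Prop :=
  exists z z' : floyd_boundary lam, [/\ x = inr z, y = inr z' & F z = F z'].

Definition shortcut_predist (o : G) (x y : floyd_completion lam) : R :=
  inf [set r | exists n (xi eta : nat -> floyd_completion lam),
    [/\ xi 0%N = x, eta n = y,
        forall i, (i < n)%N -> omega (eta i) (xi i.+1)
      & r = \sum_(i < n.+1) floyd_cdist o (xi i) (eta i)]].

Definition shortcut_dist (o : G) (x y : G + X) : R :=
  inf [set r | exists x' y', [/\ floyd_map_ext x' = x, floyd_map_ext y' = y
                               & r = shortcut_predist o x' y']].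

Definition ray_ends_at (a : nat -> G) (xi : X) : Prop :=
  exists2 z : floyd_boundary lam, sval z a & F z = xi.

End FloydMap.

(* Constant paths are excluded: their endpoints are at shortcut distance [0]
   and, in the absence of parabolics, their vertex is a transition point. *)
Definition visibility (X : metricType R) (lam1 : R)
    (F : forall lam : R, floyd_boundary lam -> X)
    (PP : set (set G)) (eps : R) : Prop :=
  forall r lam : R, 0 < r -> lam1 <= lam < 1 ->
    exists2 kappa : R, 0 < kappa &
      forall (p : epath G) (v : G), geodesic S p -> (0 < word_length p)%N ->
        transition_point S PP eps r p v ->
        kappa < shortcut_dist (F lam) v (inl (source p)) (inl (target p)).

End Floyd.

(* Main.v *)
Require Import Defs.
From HB Require Import structures.
From mathcomp Require Import all_boot all_order all_algebra.
From mathcomp Require Import finmap.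
From mathcomp Require Import all_classical all_reals all_analysis.
From mathcomp Require Import zify ring lra.

(** The shortcut distance between [xi] and [eta] is an infimum over chains in
    the Floyd boundary whose consecutive links are joined inside fibres of the
    Floyd map. Approximating the links of an almost optimal chain by paths in
    the Cayley graph gives a finite sequence of paths whose total Floyd length
    is close to the shortcut distance. It remains to see that the jumps
    between consecutive paths can be made along distinct horospheres, and that
    the sequence can be made tight without gaining Floyd length.

    Jumps ([fibre_horosphere], [fixed_point_near]). If two distinct boundary
    points have the same image, geodesics between approximations of them pass
    near [o] by Karlsson's lemma, while their endpoints become arbitrarily
    close in the shortcut metric. By visibility their vertices near [o] are
    not transition points, so there the geodesics follow a horosphere, from
    points close to one boundary point to points close to the other. Different
    jumps use different horospheres provided that their fibres differ: an
    element of a coset [a P] is, up to bounded distance, an element of the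
    stabilizer of the corresponding parabolic point [q]; if it is Floyd-close
    to a boundary point [z], north-south dynamics forces [q] to be close to
    the image of [z]. A single horosphere therefore cannot come close to two
    fibres. The fibres are made distinct by shortening the chain
    ([boundary_chain_reduce]).

    Tightness ([tighten], [merge_paths], [jumping_paths_tighten]). For [lam]
    close to [1], depending on [l], a path of [n <= l] edges is Floyd-shorter
    than any path with more edges from the same vertex. Hence a geodesic can
    replace every subpath violating tightness. If the entry point and the exit
    point at some jump are closer than [l], the jump is abandoned: the two paths
    are cut there and joined by a geodesic. This costs little if it happens far
    from [o], and otherwise the geodesic replaces a long end of the first path.
    Every merge lowers the number of jumps, which is bounded by that of the
    initial chain, so the total cost of the merges is under control.

    Lower bound ([shortcut_dist_jumping]). Merging only deletes jumps. The
    remaining ones still have their ends close to two points of one fibre, so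
    the resulting paths determine a chain, whose length is at most their total
    Floyd length up to a small error. *)

Set Implicit Arguments.
Unset Strict Implicit.
Unset Printing Implicit Defensive.

Import Order.TTheory GRing.Theory Num.Theory.
Import numFieldNormedType.Exports.

Local Open Scope classical_set_scope.
Local Open Scope ring_scope.

(** * Paths in the Cayley graph and the word metric *)

Section Paths.
Variables (G : groupType) (S : {fset G}).
Implicit Types (x y z g : G) (p q : epath G) (s : seq G).

Definition epath_cat p q : epath G := (p.1, p.2 ++ q.2).
Definition epath_rev p : epath G := (target p, rev (belast p.1 p.2)).
Definition epath_mul g p : epath G := ((g * p.1)%g, map (fun h => g * h)%g p.2).

Lemma vertices_rev p : vertices (epath_rev p) = rev (vertices p).
Proof.
by case: p => x s; rewrite /vertices /epath_rev /target /= [in RHS]lastI rev_rcons.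
Qed.


Lemma path_betweenP x y p :
  path_between S x y p <->
  exists s, [/\ p = (x, s), path (cayley S) x s & last x s = y].
Proof.
split=> [[]|[s [-> ps ls]]] //; case: p => [x' s] ps /= <- ls.
by exists s.
Qed.

Lemma path_between_cat x y z p q :
  path_between S x y p -> path_between S y z q ->
  path_between S x z (epath_cat p q).
Proof.
move=> /path_betweenP[s [-> ps ls]] /path_betweenP[s' [-> ps' ls']].
apply/path_betweenP; exists (s ++ s'); split=> //.
  by rewrite cat_path ps ls.
by rewrite last_cat ls.
Qed.

Lemma word_length_cat p q :
  word_length (epath_cat p q) = (word_length p + word_length q)%N.
Proof. exact: size_cat. Qed.

Lemma word_length_rev p : word_length (epath_rev p) = word_length p.
Proof. by rewrite /word_length size_rev size_belast. Qed.

Lemma cayley_trans g x y : cayley S (g * x)%g (g * y)%g = cayley S x y.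
Proof. by rewrite /cayley invgM -mulgA mulKg. Qed.

Lemma path_between_trans g x y p :
  path_between S x y p -> path_between S (g * x)%g (g * y)%g (epath_mul g p).
Proof.
move=> /path_betweenP[s [-> ps ls]]; apply/path_betweenP.
exists (map (fun h => g * h)%g s); split=> //; last by rewrite last_map ls.
by rewrite path_map (eq_path (e' := cayley S)) // => u v; rewrite /= cayley_trans.
Qed.

Lemma word_length_trans g p : word_length (epath_mul g p) = word_length p.
Proof. exact: size_map. Qed.

(** All later surgery on paths starts from this decomposition. *)
Lemma path_split p i j : (i <= j)%N -> (j <= word_length p)%N -> is_path S p ->
  exists p1 p3, [/\ p = epath_cat p1 (epath_cat (subpath p i j) p3),
    path_between S (source p) (vertex p i) p1,
    path_between S (vertex p i) (vertex p j) (subpath p i j),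
    path_between S (vertex p j) (target p) p3 &
    [/\ word_length p1 = i, word_length (subpath p i j) = (j - i)%N &
        word_length p3 = (word_length p - j)%N]].
Proof.
case: p => x s; rewrite /word_length /is_path /= => ij js ps.
have vE k : (k <= size s)%N -> vertex (x, s) k = last x (take k s).
  move=> ks; rewrite (last_nth x) size_takel // /vertex /vertices /=.
  by case: k ks => //= k ks; rewrite nth_take.
have tE : take j s = take i s ++ take (j - i) (drop i s).
  by rewrite -{1}(subnKC ij) takeD.
have sE : s = take i s ++ take (j - i) (drop i s) ++ drop j s.
  by rewrite catA -tE cat_take_drop.
have is_ := leq_trans ij js.
move: (ps); rewrite {1}sE cat_path -vE // cat_path vE // -last_cat -tE -vE //.
move=> /and3P[p1 p2 p3].
exists (x, take i s), (vertex (x, s) j, drop j s); split.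
- by rewrite /epath_cat /= -sE.
- by apply/path_betweenP; exists (take i s); rewrite vE.
- apply/path_betweenP; exists (take (j - i) (drop i s)); split=> //.
  by rewrite !vE // -last_cat -tE.
- apply/path_betweenP; exists (drop j s); rewrite vE //; split=> //.
  by rewrite -last_cat cat_take_drop.
- by split; rewrite /= ?size_drop // size_takel // size_drop leq_sub2r.
Qed.

Lemma vertex0 p : vertex p 0 = source p.
Proof. by []. Qed.

Lemma vertex_last p : vertex p (word_length p) = target p.
Proof. by rewrite /target (last_nth p.1). Qed.

Lemma mem_vertex p i : (i <= word_length p)%N -> vertex p i \in vertices p.
Proof. by move=> ip; rewrite mem_nth. Qed.

Lemma vertex_rev p i : (i <= word_length p)%N ->
  vertex (epath_rev p) i = vertex p (word_length p - i).
Proof.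
move=> ip; rewrite /vertex vertices_rev nth_rev //.
have -> : (size (vertices p) - i.+1 = word_length p - i)%N by rewrite /= subSS.
by apply: set_nth_default; rewrite /= ltnS leq_subr.
Qed.

Hypothesis hS : symmetric_generating_set S.

Lemma cayley_sym x y : cayley S x y = cayley S y x.
Proof.
have [_ hV _] := hS; apply/idP/idP => /hV; rewrite invgM invgK => h; exact: h.
Qed.

Lemma path_between_rev x y p :
  path_between S x y p -> path_between S y x (epath_rev p).
Proof.
move=> /path_betweenP[s [-> ps ls]]; apply/path_betweenP.
exists (rev (belast x s)); split; first by rewrite /epath_rev /target /= ls.
  by rewrite -ls rev_path (eq_path (e' := cayley S)) // => u v; rewrite /= cayley_sym.
by case: s {ps} ls => [<-|z s _] //=; rewrite rev_cons last_rcons.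
Qed.

Lemma path_exists x y : exists p, path_between S x y p.
Proof.
have [_ _ hgen] := hS; have [w wS xyE] := hgen (x^-1 * y)%g.
have -> : y = (x * \prod_(s <- w) s)%g by rewrite -xyE mulgA mulgV mul1g.
elim: w wS x {xyE} => [|s w IH] wS x.
  by exists (x, [::]); apply/path_betweenP; exists [::]; rewrite big_nil mulg1.
have [|p pp] := IH _ (x * s)%g; first by move=> t tw; rewrite wS // in_cons tw orbT.
exists (epath_cat (x, [:: (x * s)%g]) p); rewrite big_cons mulgA.
apply: (path_between_cat _ pp); apply/path_betweenP; exists [:: (x * s)%g]; split=> //.
by rewrite /= /cayley mulKg wS // in_cons eqxx.
Qed.

Local Notation d := (word_dist S).

Lemma word_dist_spec x y :
  (exists2 p, path_between S x y p & word_length p = d x y) /\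
  (forall p, path_between S x y p -> (d x y <= word_length p)%N).
Proof.
apply: (@getPex _ [set n | (exists2 p, path_between S x y p & word_length p = n) /\
  (forall p, path_between S x y p -> (n <= word_length p)%N)]).
pose P n := `[< exists2 p, path_between S x y p & word_length p = n >].
have exP : exists n, P n.
  by have [p pp] := path_exists x y; exists (word_length p); apply/asboolP; exists p.
case: (ex_minnP exP) => n /asboolP Pn nmin; exists n; split=> // p pp.
by apply: nmin; apply/asboolP; exists p.
Qed.

Lemma geodesic_exists x y :
  exists2 p, path_between S x y p & word_length p = d x y.
Proof. exact: (word_dist_spec x y).1. Qed.

Lemma word_dist_le x y p : path_between S x y p -> (d x y <= word_length p)%N.
Proof. exact: (word_dist_spec x y).2. Qed.

Lemma word_distC x y : d x y = d y x.
Proof.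
suff H u v : (d u v <= d v u)%N by apply/eqP; rewrite eqn_leq !H.
have [p /path_between_rev pp <-] := geodesic_exists v u.
by rewrite -word_length_rev word_dist_le.
Qed.

Lemma word_dist_triangle y x z : (d x z <= d x y + d y z)%N.
Proof.
have [p pp <-] := geodesic_exists x y; have [q qq <-] := geodesic_exists y z.
by rewrite -word_length_cat word_dist_le //; apply: path_between_cat pp qq.
Qed.

Lemma word_dist_trans g x y : d (g * x)%g (g * y)%g = d x y.
Proof.
suff H h u v : (d (h * u)%g (h * v)%g <= d u v)%N.
  apply/eqP; rewrite eqn_leq H /=.
  by rewrite -{1}(mulKg g x) -{1}(mulKg g y) H.
have [p pp <-] := geodesic_exists u v.
by rewrite -(word_length_trans h) word_dist_le //; apply: path_between_trans.
Qed.

Lemma word_dist0 x : d x x = 0%N.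
Proof.
apply/eqP; rewrite -leqn0.
by apply: (@word_dist_le x x (x, [::])); apply/path_betweenP; exists [::].
Qed.

Lemma word_dist_eq0 x y : d x y = 0%N -> x = y.
Proof.
by have [p /path_betweenP[s [-> _ <-]] <-] := geodesic_exists x y; case: s.
Qed.

Lemma word_dist_edge x y : cayley S x y -> (d x y <= 1)%N.
Proof.
move=> xy; apply: (@word_dist_le x y (x, [:: y])).
by apply/path_betweenP; exists [:: y]; rewrite /= xy.
Qed.

Lemma geodesicP x y p : path_between S x y p -> word_length p = d x y ->
  geodesic S p.
Proof. by case=> pp sp tp lp; split=> //; rewrite sp tp. Qed.

Lemma geodesic_vertex_dist p i j : geodesic S p ->
  (i <= j)%N -> (j <= word_length p)%N -> d (vertex p i) (vertex p j) = (j - i)%N.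
Proof.
move=> [pp lp] ij jp.
have [p1 [p3 [_ /word_dist_le d1 /word_dist_le d2 /word_dist_le d3 [l1 l2 l3]]]] :=
  path_split ij jp pp.
have := word_dist_triangle (vertex p i) (source p) (target p).
have := word_dist_triangle (vertex p j) (vertex p i) (target p).
lia.
Qed.

Lemma geodesic_subpath p i j : geodesic S p -> (i <= j)%N ->
  (j <= word_length p)%N -> geodesic S (subpath p i j).
Proof.
move=> gp ij jp; have [pp _] := gp.
have [p1 [p3 [_ _ h2 _ [_ l2 _]]]] := path_split ij jp pp.
by apply: (geodesicP h2); rewrite l2 geodesic_vertex_dist.
Qed.

Lemma geodesic_quasi (R : realType) p : geodesic S p -> quasi_geodesic S (1 : R) p.
Proof.
move=> gp; have [pp _] := gp; split=> // i j ij jp.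
have [_ ->] := geodesic_subpath gp ij jp.
by rewrite mul1r lerDl.
Qed.

End Paths.

(** * Floyd lengths and Floyd distances *)

Section FloydLength.
Variables (R : realType) (G : groupType) (S : {fset G}).
Hypothesis hS : symmetric_generating_set S.
Variable lam : R.
Hypothesis lam01 : 0 < lam < 1.
Implicit Types (o x y z g : G) (p q : epath G) (s : seq G) (n k i j : nat).

Local Notation d := (word_dist S).
Local Notation fl := (floyd_length S lam).
Local Notation fd := (floyd_dist S lam).

Let lam_gt0 : 0 < lam. Proof. by case/andP: lam01. Qed.
Let lam_le1 : lam <= 1. Proof. by case/andP: lam01 => _ /ltW. Qed.
Let lamX_ge0 n : 0 <= lam ^+ n. Proof. exact/exprn_ge0/ltW. Qed.
Let lamX_gt0 n : 0 < lam ^+ n. Proof. exact: exprn_gt0. Qed.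
Let lamX_anti m n : (m <= n)%N -> lam ^+ n <= lam ^+ m.
Proof. by move=> mn; apply: ler_wiXn2l => //; apply: ltW. Qed.

Lemma floyd_length_nil o x : fl o (x, [::]) = 0.
Proof. by rewrite /floyd_length big_nil. Qed.

Lemma floyd_length_cons o x y s :
  fl o (x, y :: s) = lam ^+ edge_dist S o (x, y) + fl o (y, s).
Proof. by rewrite /floyd_length /= big_cons. Qed.

Lemma floyd_length_cat o p q : source q = target p ->
  fl o (epath_cat p q) = fl o p + fl o q.
Proof.
case: p q => x s [x' s']; rewrite /source /target /epath_cat /= => ->.
elim: s x => [|y s IH] x /=; first by rewrite floyd_length_nil add0r.
by rewrite !floyd_length_cons IH addrA.
Qed.

Lemma floyd_length_between o x y z p q :
  path_between S x y p -> path_between S y z q ->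
  fl o (epath_cat p q) = fl o p + fl o q.
Proof. by move=> [_ _ tp] [_ sq _]; rewrite floyd_length_cat ?tp. Qed.

Lemma floyd_length_ge0 o p : 0 <= fl o p.
Proof. by apply: sumr_ge0. Qed.

Lemma edge_distC o x y : edge_dist S o (x, y) = edge_dist S o (y, x).
Proof. exact: minnC. Qed.

Lemma floyd_length_rev o p : fl o (epath_rev p) = fl o p.
Proof.
case: p => x s; elim: s x => [|y s IH] x //.
have -> : epath_rev (x, y :: s) = epath_cat (epath_rev (y, s)) (y, [:: x]).
  by rewrite /epath_cat /epath_rev /target /= rev_cons cats1.
rewrite floyd_length_cat ?IH; last first.
  by rewrite /target -nth_last /epath_rev /=; case: s {IH} => //= z s;
     rewrite size_rev /= rev_cons nth_rcons size_rev /= ltnn eqxx.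
by rewrite !floyd_length_cons floyd_length_nil addr0 edge_distC addrC.
Qed.

Lemma floyd_length_trans o g p : fl (g * o)%g (epath_mul g p) = fl o p.
Proof.
case: p => x s; elim: s x => [|y s IH] x; first by rewrite !floyd_length_nil.
rewrite /epath_mul /= !floyd_length_cons; congr (_ + _); last exact: IH.
by rewrite /edge_dist /= !word_dist_trans.
Qed.

Lemma floyd_length_base o o' p : fl o p * lam ^+ d o o' <= fl o' p.
Proof.
case: p => x s; elim: s x => [|y s IH] x.
  by rewrite !floyd_length_nil mul0r.
rewrite !floyd_length_cons mulrDl lerD // -exprD lamX_anti // /edge_dist /=.
have := word_dist_triangle hS o o' x; have := word_dist_triangle hS o o' y.
by rewrite (word_distC hS o' o); lia.
Qed.

Lemma floyd_length_le o p n a : (forall v, v \in vertices p -> (a <= d o v + n)%N) ->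
  fl o p * lam ^+ n <= (word_length p)%:R * lam ^+ a.
Proof.
case: p => x s; elim: s x => [|y s IH] x h.
  by rewrite floyd_length_nil !mul0r.
rewrite floyd_length_cons /word_length /= -natr1 !mulrDl mul1r addrC.
apply: lerD; first by apply: IH => v vs; apply: h; rewrite inE vs orbT.
rewrite -exprD lamX_anti // /edge_dist /=.
have := h x (mem_head _ _); have := h y; rewrite !inE eqxx orbT => /(_ isT).
lia.
Qed.

Lemma floyd_length_ge o p k : is_path S p -> (k <= word_length p)%N ->
  k%:R * lam ^+ (d o (source p) + k) <= fl o p.
Proof.
case: p => x s; rewrite /is_path /word_length /source /=.
elim: k s x => [|k IH] [|y s] x //=; rewrite ?mul0r ?floyd_length_ge0 //.
move=> /andP[/(word_dist_edge hS) xy ps]; rewrite ltnS => ks.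
rewrite floyd_length_cons -nat1r mulrDl mul1r; apply: lerD.
  by apply: lamX_anti; rewrite /edge_dist /=; lia.
apply: le_trans (IH _ _ ps ks); rewrite ler_wpM2l // lamX_anti //.
by have := word_dist_triangle hS x o y; lia.
Qed.

(** Near a given vertex the weights vary by bounded factors only, so for
    [lam] close to [1] a path of [n] edges is Floyd-shorter than any path
    with more edges that starts at the same vertex. *)
Lemma floyd_length_detour N o p q :
  N%:R <= N.+1%:R * lam ^+ (2 * N).+1 ->
  is_path S p -> is_path S q -> source p = source q ->
  (word_length q <= N)%N -> (word_length q < word_length p)%N -> fl o q <= fl o p.
Proof.
move=> hN pp pq spq; set n := word_length q => nN np.
have hn : n%:R <= n.+1%:R * lam ^+ (2 * n).+1.
  have N0 : (0 : R) < N.+1%:R by rewrite ltr0n.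
  have n0 : (0 : R) < n.+1%:R by rewrite ltr0n.
  have e1 : n%:R * N.+1%:R <= N%:R * n.+1%:R :> R by rewrite -!natrM ler_nat; lia.
  have e2 : lam ^+ (2 * N).+1 <= lam ^+ (2 * n).+1 by rewrite lamX_anti //; lia.
  rewrite -(ler_pM2l N0) mulrC; apply: (le_trans e1).
  apply: (le_trans (ler_wpM2r (ltW n0) hN)).
  by rewrite mulrAC mulrA ler_wpM2l // mulr_ge0 // ltW.
have q1 : fl o q * lam ^+ n <= n%:R * lam ^+ d o (source q).
  apply: floyd_length_le => v /(nthP (source q))[i iq <-].
  move: iq; rewrite /= ltnS => iq.
  have [p1 [p3 [_ /(word_dist_le hS) h _ _ [l1 _ _]]]] := path_split iq (leqnn _) pq.
  have := word_dist_triangle hS (vertex q i) o (source q).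
  rewrite (word_distC hS (vertex q i)) /vertex -/(source q); move: h; rewrite l1 /vertex.
  by rewrite -/(source q) -/(word_length q) -/n in iq *; lia.
have p1 := floyd_length_ge o pp np.
rewrite -(ler_pM2r (lamX_gt0 n)); apply: (le_trans q1).
apply: (@le_trans _ _ (n.+1%:R * lam ^+ (2 * n).+1 * lam ^+ d o (source q))).
  by rewrite ler_wpM2r.
apply: le_trans (ler_wpM2r (lamX_ge0 n) p1).
rewrite spq -!mulrA -!exprD; apply: ler_wpM2l => //.
by rewrite lamX_anti //; lia.
Qed.

Let fl_inf o x y : has_inf (fl o @` path_between S x y).
Proof.
split; last by exists 0 => _ [p _ <-]; apply: floyd_length_ge0.
by have [p pp] := path_exists hS x y; exists (fl o p), p.
Qed.

Lemma floyd_dist_le o x y p : path_between S x y p -> fd o x y <= fl o p.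
Proof. by move=> pp; apply: ge_inf; [exact: (fl_inf o x y).2 | exists p]. Qed.

Lemma floyd_dist_path o x y e : 0 < e ->
  exists2 p, path_between S x y p & fl o p < fd o x y + e.
Proof.
by move=> /(inf_adherent)/(_ (fl_inf o x y))[_ [p pp <-] h]; exists p.
Qed.

Lemma floyd_dist_ge o x y r :
  (forall p, path_between S x y p -> r <= fl o p) -> r <= fd o x y.
Proof. by move=> h; apply: lb_le_inf; [exact: (fl_inf o x y).1|move=> _ [p /h ? <-]]. Qed.

Lemma floyd_dist_ge0 o x y : 0 <= fd o x y.
Proof. by apply: floyd_dist_ge => p _; apply: floyd_length_ge0. Qed.

Lemma floyd_dist0 o x : fd o x x = 0.
Proof.
apply/eqP; rewrite eq_le floyd_dist_ge0 andbT -(floyd_length_nil o x).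
by apply: floyd_dist_le; apply/path_betweenP; exists [::].
Qed.

Lemma floyd_distC o x y : fd o x y = fd o y x.
Proof.
suff H u v : fd o u v <= fd o v u by apply/eqP; rewrite eq_le !H.
apply: floyd_dist_ge => p /(path_between_rev hS) pp.
by rewrite -floyd_length_rev floyd_dist_le.
Qed.

Lemma floyd_dist_triangle y o x z : fd o x z <= fd o x y + fd o y z.
Proof.
rewrite -lerBlDr; apply: floyd_dist_ge => p pp; rewrite lerBlDl -lerBlDr.
apply: floyd_dist_ge => q qq; rewrite lerBlDr addrC.
rewrite -floyd_length_cat; last by case: pp => _ _ ->; case: qq.
exact/floyd_dist_le/(path_between_cat pp).
Qed.

Lemma floyd_dist_trans o g x y : fd (g * o)%g (g * x)%g (g * y)%g = fd o x y.
Proof.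
suff H h a u v : fd (h * a)%g (h * u)%g (h * v)%g <= fd a u v.
  apply/eqP; rewrite eq_le H /= -{1}(mulKg g o) -{1}(mulKg g x) -{1}(mulKg g y).
  exact: H.
apply: floyd_dist_ge => p pp; rewrite -(floyd_length_trans a h).
exact/floyd_dist_le/path_between_trans.
Qed.

Lemma floyd_dist_base o o' x y : fd o x y * lam ^+ d o o' <= fd o' x y.
Proof.
apply: floyd_dist_ge => p pp; apply: le_trans (floyd_length_base o o' p).
by rewrite ler_wpM2r // floyd_dist_le.
Qed.

Lemma floyd_dist_neq o x y : x <> y -> lam ^+ d o x <= fd o x y.
Proof.
move=> xy; apply: floyd_dist_ge => p /path_betweenP[[|z s] [-> _ /= yE]].
  by case: xy.
rewrite floyd_length_cons; apply: (@le_trans _ _ (lam ^+ edge_dist S o (x, z))).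
  by rewrite lamX_anti // geq_minl.
by rewrite lerDl floyd_length_ge0.
Qed.

Lemma floyd_dist_near o x y n : (d x y <= n)%N ->
  fd o x y * lam ^+ n <= n%:R * lam ^+ d o x.
Proof.
move=> xyn; have [p pp lp] := geodesic_exists hS x y.
apply: (@le_trans _ _ (fl o p * lam ^+ n)); first by rewrite ler_wpM2r // floyd_dist_le.
apply: (@le_trans _ _ ((word_length p)%:R * lam ^+ d o x)); last first.
  by rewrite ler_wpM2r // ler_nat lp.
apply: floyd_length_le => v /(nthP (source p))[i ip <-].
move: ip; rewrite /= ltnS -/(word_length p) -/(vertex p i) => ip.
have := geodesic_vertex_dist hS (geodesicP pp lp) (leq0n i) ip.
rewrite vertex0; have [_ -> _] := pp.
have := word_dist_triangle hS (vertex p i) o x.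
rewrite (word_distC hS (vertex p i)); lia.
Qed.

End FloydLength.

(** * Geodesics far from the base point are Floyd-short *)

Lemma vertex_subpath (G : groupType) (p : epath G) i j k :
  (i <= j)%N -> (j <= word_length p)%N -> (k <= j - i)%N ->
  vertex (subpath p i j) k = vertex p (i + k).
Proof.
move=> ij jp kij; case: k kij => [|k] kij; first by rewrite addn0.
rewrite /vertex /subpath /= nth_take // nth_drop addnS /=.
by apply: set_nth_default; move: jp; rewrite /word_length; lia.
Qed.

Section Karlsson.
Variables (R : realType) (G : groupType) (S : {fset G}).
Hypothesis hS : symmetric_generating_set S.
Variable lam : R.
Hypothesis lam01 : 0 < lam < 1.
Implicit Types (o x y z g : G) (p q : epath G) (n k i j : nat).

Local Notation d := (word_dist S).
Local Notation fl := (floyd_length S lam).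
Local Notation fd := (floyd_dist S lam).

Let lam_gt0 : 0 < lam. Proof. by case/andP: lam01. Qed.
Let lam_lt1 : lam < 1. Proof. by case/andP: lam01. Qed.

(** A rate slower than [lam] such that [lam <= mu ^+ 3]: distances to the
    base point along a geodesic grow only a third as fast as the estimates
    below want to count. *)
Definition decay_rate : R := 1 - (1 - lam) / 3.
Local Notation mu := decay_rate.

Lemma decay_rate_gt0 : 0 < mu.
Proof. by have := lam_gt0; rewrite /decay_rate; lra. Qed.

Lemma decay_rate_lt1 : mu < 1.
Proof. by have := lam_lt1; rewrite /decay_rate; lra. Qed.

Let mu_ge0 := ltW decay_rate_gt0.
Let mu_le1 := ltW decay_rate_lt1.

Lemma decay_rateX3 n : lam ^+ n <= mu ^+ (3 * n).
Proof.
have [l0 l1] := (lam_gt0, lam_lt1).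
rewrite exprM; apply: lerXn2r; rewrite ?nnegrE ?exprn_ge0 //; first exact: ltW.
rewrite /decay_rate; set s := (1 - lam) / 3.
have -> : lam = (1 - s) ^+ 3 - s ^+ 2 * (3 - s) by rewrite /s; field.
by rewrite lerBlDr lerDl mulr_ge0 ?sqr_ge0 // /s; lra.
Qed.

Lemma floyd_length_decay o p c :
  (forall i, (i <= word_length p)%N -> (c + i <= 3 * d o (vertex p i))%N) ->
  fl o p <= mu ^+ c / (1 - mu).
Proof.
have mu1 : 0 < 1 - mu by have := decay_rate_lt1; lra.
case: p => x s; rewrite /word_length /=; elim: s x c => [|y s IH] x c h.
  by rewrite floyd_length_nil divr_ge0 ?exprn_ge0 // ltW.
have {}IH := IH y c.+1.
rewrite floyd_length_cons.
have -> : mu ^+ c / (1 - mu) = mu ^+ c + mu ^+ c.+1 / (1 - mu).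
  by rewrite exprS; field; rewrite gt_eqF.
apply: lerD; last first.
  apply: IH => i js; have := h i.+1; rewrite /= ltnS => /(_ js).
  by rewrite addSnnS /vertex /= (set_nth_default y).
apply: (le_trans (decay_rateX3 _)); apply: ler_wiXn2l => //.
have := h 0%N (leq0n _); have := h 1%N; rewrite /edge_dist /vertex /=.
by move=> /(_ isT); lia.
Qed.

Section Nearest.
Variables (o : G) (p : epath G) (i0 : nat).
Hypotheses (gp : geodesic S p) (i0p : (i0 <= word_length p)%N).
Hypothesis i0min : forall i, (i <= word_length p)%N ->
  (d o (vertex p i0) <= d o (vertex p i))%N.

(** Both [d o v <= d o (vertex p i)], with [v] the nearest vertex, and
    [d v (vertex p i) <= d o v + d o (vertex p i)] bound the distance from [o]
    from below; their combination grows linearly in [i]. *)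
Lemma floyd_dist_after_nearest j : (i0 <= j)%N -> (j <= word_length p)%N ->
  fd o (vertex p j) (target p) <= mu ^+ (d o (vertex p i0) + (j - i0)) / (1 - mu).
Proof.
move=> ij jp; have [pp _] := gp.
have [p1 [p3 [_ _ h2 _ [_ l2 _]]]] := path_split jp (leqnn _) pp.
rewrite -vertex_last; apply: (le_trans (floyd_dist_le hS lam01 o h2)).
apply: floyd_length_decay => k; rewrite l2 => kp; rewrite vertex_subpath //.
have h : (j + k <= word_length p)%N by lia.
have := i0min h; have := word_dist_triangle hS o (vertex p i0) (vertex p (j + k)).
by rewrite (word_distC hS (vertex p i0) o) geodesic_vertex_dist //; lia.
Qed.

End Nearest.

Lemma geodesic_rev p : geodesic S p -> geodesic S (epath_rev p).
Proof.
move=> [pp lp]; apply: (geodesicP (x := target p) (y := source p)).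
  exact: path_between_rev.
by rewrite word_length_rev lp word_distC.
Qed.

Lemma floyd_dist_before_nearest o p i0 j : geodesic S p ->
  (i0 <= word_length p)%N ->
  (forall i, (i <= word_length p)%N -> (d o (vertex p i0) <= d o (vertex p i))%N) ->
  (j <= i0)%N ->
  fd o (source p) (vertex p j) <= mu ^+ (d o (vertex p i0) + (i0 - j)) / (1 - mu).
Proof.
move=> gp i0p i0min ji; set n := word_length p in i0p *.
have vE i : (i <= n)%N -> vertex (epath_rev p) (n - i) = vertex p i.
  by move=> ip; rewrite vertex_rev ?leq_subr // subKn.
have := @floyd_dist_after_nearest o (epath_rev p) (n - i0) (geodesic_rev gp).
rewrite word_length_rev -/n leq_subr => /(_ isT).
have h i : (i <= n)%N ->
    (d o (vertex (epath_rev p) (n - i0)) <= d o (vertex (epath_rev p) i))%N.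
  by move=> ip; rewrite vE // vertex_rev // i0min // leq_subr.
move=> /(_ h (n - j)%N).
rewrite leq_sub2l // leq_subr => /(_ isT isT).
rewrite !vE ?(leq_trans ji) // floyd_distC // -[target (epath_rev p)]vertex_last.
rewrite word_length_rev -/n -{1}(subn0 n) vE //.
by rewrite (_ : (n - j - (n - i0)) = i0 - j)%N //; lia.
Qed.

Lemma nearest_vertex o p : exists2 i0, (i0 <= word_length p)%N &
  forall i, (i <= word_length p)%N -> (d o (vertex p i0) <= d o (vertex p i))%N.
Proof.
pose f (i : 'I_(word_length p).+1) := d o (vertex p i).
have [i _ imin] := @arg_minnP _ ord0 xpredT f isT.
exists (val i); first by rewrite -ltnS (ltn_ord i).
by move=> j jp; have := imin (inord j) isT; rewrite /f inordK.
Qed.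

(** Karlsson's lemma: on both sides of the vertex nearest to [o] the edges
    contribute a geometric series. *)
Lemma floyd_dist_karlsson o p D : geodesic S p ->
  (forall i, (i <= word_length p)%N -> (D <= d o (vertex p i))%N) ->
  fd o (source p) (target p) <= 2 * (mu ^+ D / (1 - mu)).
Proof.
move=> gp pD; have [i0 i0p i0min] := nearest_vertex o p.
have mu1 : 0 <= (1 - mu)^-1 by rewrite invr_ge0; have := decay_rate_lt1; lra.
have e1 := floyd_dist_after_nearest gp i0p i0min (leqnn _) i0p.
have e2 := floyd_dist_before_nearest gp i0p i0min (leqnn _).
apply: (le_trans (floyd_dist_triangle hS lam01 (vertex p i0) o _ _)).
have e3 : mu ^+ (d o (vertex p i0)) / (1 - mu) <= mu ^+ D / (1 - mu).
  by rewrite ler_wpM2r // ler_wiXn2l // pD.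
by rewrite subnn addn0 in e1 e2; lra.
Qed.

(** Here the base point is an end of the geodesic, hence its nearest vertex. *)
Lemma floyd_dist_geodesic_tail p i : geodesic S p -> (i <= word_length p)%N ->
  fd (source p) (vertex p i) (target p) <= mu ^+ i / (1 - mu).
Proof.
move=> gp ip; have := @floyd_dist_after_nearest (source p) p 0 gp isT.
rewrite vertex0 word_dist0 // => /(_ (fun=> fun=> isT) i isT ip).
by rewrite subn0 add0n.
Qed.

End Karlsson.

(** * The Floyd completion *)

Lemma ball_finite (G : groupType) (S : {fset G}) (hS : symmetric_generating_set S)
  (k : nat) : finite_set [set x | (word_dist S 1%g x <= k)%N].
Proof.
elim: k => [|k IH].
  apply: sub_finite_set (finite_set1 (1%g : G)) => x /=; rewrite leqn0 => /eqP.
  by move=> /(word_dist_eq0 hS) ->.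
pose B := [set x | (word_dist S 1%g x <= k)%N].
pose f (t : G * G) : G := (t.1 * t.2)%g.
have fB : finite_set (B `|` f @` (B `*` [set` S])).
  rewrite finite_setU; split=> //; apply: finite_image.
  by apply: finite_setX.
apply: sub_finite_set fB => x /=; rewrite leq_eqVlt ltnS => /orP[/eqP xk|]; last by left.
have [p /path_betweenP[s [-> ps xE]] lp] := geodesic_exists hS 1%g x; right.
move: ps xE lp; case/lastP: s => [|s y]; rewrite /word_length /= ?xk // size_rcons.
rewrite rcons_path last_rcons => /andP[ps sy] <- [sk].
exists (last 1%g s, (last 1%g s)^-1 * y)%g; last by rewrite /f /= mulVKg.
split=> //=; rewrite /B /= -sk; apply: (@word_dist_le _ _ hS _ _ (1%g, s)).
by apply/path_betweenP; exists s.
Qed.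

Section Completion.
Variables (R : realType) (G : groupType) (S : {fset G}).
Hypothesis hS : symmetric_generating_set S.
Variable lam : R.
Hypothesis lam01 : 0 < lam < 1.
Implicit Types (o g h : G) (u v w : nat -> G).

Local Notation d := (word_dist S).
Local Notation fd := (floyd_dist S lam).
Local Notation FB := (floyd_boundary S lam).
Local Notation FC := (floyd_completion S lam).
Local Notation cd := (@floyd_cdist R G S lam).
Local Notation cauchy := (floyd_cauchy S lam).
Local Notation close := (floyd_close S lam).
Local Notation approx := (@Defs.approx R G S lam).
Implicit Types (x y : FC) (z : FB).

Let lam_gt0 : 0 < lam. Proof. by case/andP: lam01. Qed.
Let lamX_gt0 n : 0 < lam ^+ n. Proof. exact: exprn_gt0. Qed.
Let tri := @floyd_dist_triangle R G S hS lam lam01.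
Let fd_ge0 := @floyd_dist_ge0 R G S hS lam lam01.
Let fdC := @floyd_distC R G S hS lam lam01.
Let fd0 := @floyd_dist0 R G S hS lam lam01.

(** Convergence of [u] to [x] in the completion. *)
Definition represents x u := cauchy u /\ close (approx x) u.

Lemma floyd_closeP u v : close u v <->
  forall e, 0 < e -> \forall n \near \oo, fd 1%g (u n) (v n) < e.
Proof.
rewrite /floyd_close; split=> [/cvgrPdist_lt h e e0|h].
  by apply: filterS (h e e0) => n; rewrite sub0r normrN ger0_norm.
by apply/cvgrPdist_lt => e e0; apply: filterS (h e e0) => n; rewrite sub0r normrN ger0_norm.
Qed.

Lemma floyd_close_base o u v : close u v ->
  forall e, 0 < e -> \forall n \near \oo, fd o (u n) (v n) < e.
Proof.
move=> /floyd_closeP h e e0; have l0 := lamX_gt0 (d o 1%g).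
apply: filterS (h _ (mulr_gt0 e0 l0)) => n hn.
rewrite -(ltr_pM2r l0); apply: le_lt_trans hn.
exact: floyd_dist_base.
Qed.

Lemma floyd_close_trans u v w : close u v -> close v w -> close u w.
Proof.
move=> /floyd_closeP h /floyd_closeP h'; apply/floyd_closeP => e e0.
near=> n; apply: le_lt_trans (tri (v n) _ _ _) _.
rewrite (splitr e); apply: ltrD; near: n; [apply: h|apply: h']; lra.
Unshelve. all: by end_near.
Qed.

Lemma floyd_close_refl u : close u u.
Proof. by apply/floyd_closeP => e e0; apply: nearW => n; rewrite fd0. Qed.

Lemma floyd_cauchy_base o u : cauchy u -> forall e, 0 < e -> exists N,
  forall m n, (N <= m)%N -> (N <= n)%N -> fd o (u m) (u n) < e.
Proof.
move=> h e e0; have l0 := lamX_gt0 (d o 1%g).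
have [N hN] := h _ (mulr_gt0 e0 l0); exists N => m n mN nN.
rewrite -(ltr_pM2r l0); apply: le_lt_trans (hN _ _ mN nN).
exact: floyd_dist_base.
Qed.

Lemma approx_cauchy x : cauchy (approx x).
Proof.
case: x => [g|[A Au]] /=; first by move=> e e0; exists 0%N => m n _ _; rewrite fd0.
by case: cid => u [].
Qed.

Lemma represents_approx x : represents x (approx x).
Proof. by split; [exact: approx_cauchy|exact: floyd_close_refl]. Qed.

Lemma represents_vertex g : represents (inl g) (fun=> g).
Proof. exact: represents_approx (inl g). Qed.

Lemma represents_boundary z u : sval z u <-> represents (inr z) u.
Proof.
rewrite /represents; case: z => A Au /=; case: cid => v [cv nv AE] /=.
by rewrite [in X in X <-> _]AE.
Qed.

Lemma boundary_not_vertex z g u : represents (inr z) u -> ~ close u (fun=> g).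
Proof.
move=> [_ zu] ug; have := floyd_close_trans zu ug.
by case: z {zu} => A Au /=; case: cid => v [cv nv _ /=]; apply: nv.
Qed.

Let fd_lip o a b a' b' : `|fd o a b - fd o a' b'| <= fd o a a' + fd o b b'.
Proof.
have h1 := tri a' o a b; have h2 := tri b' o a' b.
have h3 := tri a o a' b'; have h4 := tri b o a b'.
rewrite (fdC o b' b) in h2; rewrite (fdC o a' a) in h3.
by rewrite ler_distl; apply/andP; split; lra.
Qed.

Lemma floyd_cdist_cvg o x y u v : represents x u -> represents y v ->
  fd o (u n) (v n) @[n --> \oo] --> cd o x y.
Proof.
move=> [cu xu] [cv yv].
have cvg0 : cvg (fd o (approx x n) (approx y n) @[n --> \oo]).
  apply/cauchy_cvgP/cauchy_exP => e e0; have e2 : 0 < e / 2 by lra.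
  have [N hN] := floyd_cauchy_base o (approx_cauchy x) e2.
  have [M hM] := floyd_cauchy_base o (approx_cauchy y) e2.
  exists (fd o (approx x (N + M)%N) (approx y (N + M)%N)).
  exists (N + M)%N => // n /= nNM.
  rewrite /ball /=; apply: le_lt_trans (fd_lip _ _ _ _ _) _.
  have := hN (N + M)%N n; have := hM (N + M)%N n; rewrite !leq_addl leq_addr.
  rewrite (leq_trans (leq_addl N M) nNM) (leq_trans (leq_addr M N) nNM).
  by move=> /(_ isT isT) h1 /(_ isT isT) h2; lra.
apply/cvgrPdist_lt => e e0; near=> n.
have h1 : `|cd o x y - fd o (approx x n) (approx y n)| < e / 3.
  near: n; have /cvgrPdist_lt := cvg0; apply; lra.
have h2 : fd o (approx x n) (u n) < e / 3.
  near: n; apply: floyd_close_base => //; lra.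
have h3 : fd o (approx y n) (v n) < e / 3.
  near: n; apply: floyd_close_base => //; lra.
apply: le_lt_trans (ler_distD (fd o (approx x n) (approx y n)) _ _) _.
by apply: le_lt_trans (lerD (lexx _) (fd_lip _ _ _ _ _)) _; lra.
Unshelve. all: by end_near.
Qed.

Lemma floyd_cdist_lt o x y u v r : represents x u -> represents y v ->
  cd o x y < r -> \forall n \near \oo, fd o (u n) (v n) < r.
Proof. by move=> xu yv; apply: cvgr_lt; apply: floyd_cdist_cvg. Qed.

Lemma floyd_cdist_gt o x y u v r : represents x u -> represents y v ->
  r < cd o x y -> \forall n \near \oo, r < fd o (u n) (v n).
Proof. by move=> xu yv; apply: cvgr_gt; apply: floyd_cdist_cvg. Qed.

Lemma floyd_cdist_le o x y u v r : represents x u -> represents y v ->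
  (\forall n \near \oo, fd o (u n) (v n) <= r) -> cd o x y <= r.
Proof. by move=> xu yv; apply: cvgr_to_le; apply: floyd_cdist_cvg. Qed.

Lemma floyd_cdist_ge0 o x y : 0 <= cd o x y.
Proof.
have h := floyd_cdist_cvg (o := o) (represents_approx x) (represents_approx y).
by apply: (cvgr_to_ge h); apply: nearW.
Qed.

Lemma floyd_cdistC o x y : cd o x y = cd o y x.
Proof.
suff H a b : cd o a b <= cd o b a by apply/eqP; rewrite eq_le !H.
apply/ler_addgt0Pl => e e0.
apply: (floyd_cdist_le (represents_approx a) (represents_approx b)).
have h : cd o b a < e + cd o b a by rewrite ltrDr.
apply: filterS (floyd_cdist_lt (represents_approx b) (represents_approx a) h).
by move=> n; rewrite fdC => /ltW.
Qed.

Lemma floyd_cdist_triangle y o x x' : cd o x x' <= cd o x y + cd o y x'.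
Proof.
have [h1 h2 h3] := And3 (represents_approx x) (represents_approx y) (represents_approx x').
apply/ler_addgt0Pl => e e0; apply: (floyd_cdist_le h1 h3); near=> n.
have k1 : fd o (approx x n) (approx y n) < cd o x y + e / 2.
  near: n; apply: (floyd_cdist_lt h1 h2); lra.
have k2 : fd o (approx y n) (approx x' n) < cd o y x' + e / 2.
  near: n; apply: (floyd_cdist_lt h2 h3); lra.
by apply: le_trans (tri (approx y n) _ _ _) _; lra.
Unshelve. all: by end_near.
Qed.

Lemma floyd_cdist0 o x : cd o x x = 0.
Proof.
apply/eqP; rewrite eq_le floyd_cdist_ge0 andbT.
apply: (floyd_cdist_le (represents_approx x) (represents_approx x)).
by apply: nearW => n; rewrite fd0.
Qed.

Lemma floyd_cdist_vertex o g h : cd o (inl g) (inl h) = fd o g h.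
Proof.
exact: cvg_unique (floyd_cdist_cvg (o := o) (represents_vertex g) (represents_vertex h))
  (cvg_cst _).
Qed.

Lemma floyd_cdist_base o o' x y : cd o x y * lam ^+ d o o' <= cd o' x y.
Proof.
have [h1 h2] := (represents_approx x, represents_approx y).
rewrite -ler_pdivlMr //; apply/ler_addgt0Pl => e e0.
apply: (floyd_cdist_le h1 h2).
have h : cd o' x y < cd o' x y + e * lam ^+ d o o'.
  by rewrite ltrDl mulr_gt0.
apply: filterS (floyd_cdist_lt h1 h2 h) => n /ltW h3.
have -> : e + cd o' x y / lam ^+ d o o' = (cd o' x y + e * lam ^+ d o o') / lam ^+ d o o'.
  by rewrite mulrDl mulfK 1?addrC // gt_eqF.
by rewrite ler_pdivlMr //; apply: le_trans h3; apply: floyd_dist_base.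
Qed.

Lemma represents_cvg o x u : represents x u ->
  forall e, 0 < e -> \forall n \near \oo, cd o (inl (u n)) x < e.
Proof.
move=> xu e e0; have e2 : 0 < e / 2 by lra.
have [N hN] := floyd_cauchy_base o xu.1 e2.
exists N => // n /= nN; apply: (@le_lt_trans _ _ (e / 2)); last lra.
apply: (floyd_cdist_le (represents_vertex _) xu).
by exists N => // m /= mN; apply/ltW/hN.
Qed.

(** Every edge at [g] has at least this Floyd length, so a Cauchy sequence that
    comes closer is eventually constant. In particular vertices close to a
    boundary point are far from [o]. *)
Lemma floyd_cdist_boundary_ge o g z : lam ^+ d o g <= cd o (inl g) (inr z).
Proof.
rewrite leNgt; apply/negP => h.
have zu := represents_approx (inr z : FC).
apply: (boundary_not_vertex (g := g) zu); apply/floyd_closeP => e e0.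
apply: filterS (floyd_cdist_lt (represents_vertex g) zu h) => n hn.
have -> : approx (inr z : FC) n = g; last by rewrite fd0.
apply: contrapT => /nesym/(floyd_dist_neq hS lam01 o).
by rewrite leNgt hn.
Qed.

Lemma represents_mk_boundary u : cauchy u -> (forall g, ~ close u (fun=> g)) ->
  exists z, represents (inr z) u.
Proof.
move=> cu nu; exists (exist _ (floyd_class S lam u)
   (ex_intro _ u (And3 cu nu (erefl _)))).
by apply/represents_boundary; split=> //; apply: floyd_close_refl.
Qed.

Lemma represents_trans g z u : represents (inr z) u ->
  exists z', represents (inr z') (fun n => g * u n)%g.
Proof.
move=> zu; apply: represents_mk_boundary => [e e0|h].
  have [N hN] := floyd_cauchy_base (g^-1)%g zu.1 e0.
  exists N => m n mN nN; rewrite -(mulgV g) (floyd_dist_trans hS lam01); exact: hN.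
move=> /(floyd_close_base g) gh; apply: (boundary_not_vertex (g := (g^-1 * h)%g) zu).
apply/floyd_closeP => e /gh; apply: filterS => n.
have := floyd_dist_trans hS lam01 1%g g (u n) (g^-1 * h)%g.
by rewrite mulg1 mulVKg => <-.
Qed.

Lemma decay_rate_cvg e : 0 < e ->
  \forall k \near \oo, decay_rate lam ^+ k / (1 - decay_rate lam) < e.
Proof.
move=> e0; have m0 := decay_rate_gt0 lam01; have m1 := decay_rate_lt1 lam01.
have m2 : 0 < 1 - decay_rate lam by rewrite subr_gt0.
have : decay_rate lam ^+ k @[k --> \oo] --> (0 : R).
  by apply: cvg_expr; rewrite ger0_norm // ltW.
move=> /cvgrPdist_lt/(_ _ (mulr_gt0 e0 m2)); apply: filterS => k.
by rewrite sub0r normrN ger0_norm ?exprn_ge0 ?ltW // ltr_pdivrMr.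
Qed.

(** Sequential compactness of the completion, in terms of ultrafilters: by the
    tail estimate each ball about [1] is a net whose mesh tends to [0] with the
    radius, and an ultrafilter selects one of its finitely many vertices. *)
Lemma floyd_boundary_limit (T : Type) (U : set_system T) (h : T -> G) :
  UltraFilter U -> (forall M : nat, U [set t | (M <= d 1%g (h t))%N]) ->
  exists z, forall e, 0 < e -> U [set t | cd 1%g (inl (h t)) (inr z) < e].
Proof.
move=> UU far; pose mu := decay_rate lam.
have m0 := decay_rate_gt0 lam01; have m1 := decay_rate_lt1 lam01.
pose A k b := [set t | fd 1%g b (h t) <= mu ^+ k / (1 - mu)].
(* For [U]-almost all [t] the geodesics from [1] to [h t] leave the ball of
   radius [k] at the same vertex, which is then close to [h t]. *)
have /choice[b bP] : forall k, exists b, d 1%g b = k /\ U (A k b).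
  move=> k.
  apply: contrapT => nb.
  have fB : finite_set [set b | d 1%g b = k].
    by apply: sub_finite_set (ball_finite hS k) => b /= ->.
  have [D DE] := (finite_fsetP.1 fB).
  have UD : U (\bigcap_(i in [set` D]) ~` A k i).
    apply: filter_bigI => i iD.
    have [Ui|//] := in_ultra_setVsetC (A k i) UU.
    by case: nb; exists i; split=> //; have : [set` D] i by []; rewrite -DE.
  have [t [tD tk]] := filter_ex (filterI UD (far k)).
  have [p pp lp] := geodesic_exists hS 1%g (h t).
  have gp := geodesicP pp lp; rewrite /= -lp in tk.
  have [_ sp tp] := pp.
  have vk : d 1%g (vertex p k) = k.
    by have := geodesic_vertex_dist hS gp (leq0n k) tk; rewrite vertex0 sp subn0.
  apply: (tD (vertex p k)); first by rewrite -DE.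
  by have := floyd_dist_geodesic_tail hS lam01 gp tk; rewrite sp tp.
have cb : cauchy b.
  move=> e e0; have e2 : 0 < e / 2 by lra.
  have [N _ hN] := decay_rate_cvg e2; exists N => m n mN nN.
  have [t [t1 t2]] := filter_ex (filterI (bP m).2 (bP n).2).
  have := hN m mN; have := hN n nN; rewrite /A /= -/mu in t1 t2 *.
  by have := tri (h t) 1%g (b m) (b n); rewrite (fdC _ (h t)); lra.
have [z zb] : exists z, represents (inr z) b.
  apply: represents_mk_boundary => // g /(floyd_close_base 1%g).
  move=> /(_ _ (lamX_gt0 (d 1%g g))) hg.
  near \oo => n; have : fd 1%g (b n) g < lam ^+ d 1%g g by near: n.
  rewrite fdC ltNge => /negP; apply; apply: floyd_dist_neq => // gE.
  have := (bP n).1; rewrite -gE.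
  have : (d 1%g g < n)%N by near: n; apply: nbhs_infty_gt.
  by lia.
exists z => e e0; near \oo => n.
have n1 : cd 1%g (inl (b n)) (inr z) < e / 2.
  by near: n; apply: represents_cvg => //; lra.
have n2 : mu ^+ n / (1 - mu) < e / 2.
  by near: n; apply: decay_rate_cvg; lra.
apply: filterS (bP n).2 => t; rewrite /A /= => tn.
apply: le_lt_trans (floyd_cdist_triangle (inl (b n)) _ _ _) _.
by rewrite floyd_cdist_vertex fdC; lra.
Unshelve. all: by end_near.
Qed.

End Completion.

(** * Elements of parabolic subgroups in the Floyd completion *)

Lemma hausdorff_separation (T : topologicalType) (x y : T) :
  hausdorff_space T -> x <> y ->
  exists U V : set T, [/\ open U, open V, U x, V y & U `&` V = set0].
Proof.
rewrite open_hausdorff => h /eqP /h[[U V] /= [xU yV] [oU oV /eqP UV]].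
by exists U, V; rewrite !inE in xU yV.
Qed.

Section Dynamics.
Variables (R : realType) (G : groupType) (S : {fset G}).
Hypothesis hS : symmetric_generating_set S.
Variable lam : R.
Hypothesis lam01 : 0 < lam < 1.
Implicit Types (o g h : G) (u v w : nat -> G) (M D : nat) (e r : R).

Local Notation d := (word_dist S).
Local Notation fd := (floyd_dist S lam).
Local Notation FB := (floyd_boundary S lam).
Local Notation FC := (floyd_completion S lam).
Local Notation cd := (@floyd_cdist R G S lam).
Implicit Types (z : FB).

Let lam_gt0 : 0 < lam. Proof. by case/andP: lam01. Qed.
Let lamX_gt0 n : 0 < lam ^+ n. Proof. exact: exprn_gt0. Qed.
Let tri := @floyd_dist_triangle R G S hS lam lam01.
Let fdC := @floyd_distC R G S hS lam lam01.

Lemma lamX_cvg0 e : 0 < e -> \forall n \near \oo, lam ^+ n < e.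
Proof.
move=> e0; case/andP: lam01 => l0 l1.
have : lam ^+ n @[n --> \oo] --> (0 : R) by apply: cvg_expr; rewrite ger0_norm // ltW.
move=> /cvgrPdist_lt/(_ _ e0); apply: filterS => k.
by rewrite sub0r normrN ger0_norm ?exprn_ge0 ?ltW.
Qed.

(** North-south dynamics of large elements. A geodesic from [1] to [h] is
    moved by [g] to one from [g] to [g * h], which by Karlsson's lemma is
    Floyd-short unless it passes near [1], that is, unless the original one
    passes near the inverse of [g]; in that case [h] is Floyd-close to this
    inverse. *)
Lemma floyd_north_south e r : 0 < e -> 0 < r -> exists M, forall g h,
  (M <= d 1%g g)%N -> r <= fd 1%g (g^-1)%g h -> fd 1%g g (g * h)%g <= e.
Proof.
move=> e0 r0; near \oo => D.
have De : decay_rate lam ^+ D / (1 - decay_rate lam) < e / 2.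
  by near: D; apply: decay_rate_cvg => //; lra.
have r2 : 0 < r / 2 by lra.
have [K _ hK] := decay_rate_cvg lam01 r2.
have [N _ hN] := lamX_cvg0 (divr_gt0 (mulr_gt0 r2 (lamX_gt0 D)) (ltr0Sn R D)).
exists (N + K + D)%N => g h gM rgh.
have d1V : d 1%g (g^-1)%g = d 1%g g.
  by rewrite -(word_dist_trans hS g) mulg1 mulgV word_distC.
have [p pp lp] := geodesic_exists hS 1%g h.
have gp := geodesicP pp lp; have [_ sp tp] := pp.
have [pD|] := pselect (forall i, (i <= word_length p)%N -> (D <= d (g^-1)%g (vertex p i))%N).
  have := floyd_dist_karlsson hS lam01 gp pD; rewrite sp tp.
  have := floyd_dist_trans hS lam01 (g^-1)%g g 1%g h; rewrite mulgV mulg1 => <-.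
  lra.
move=> /existsNP[i /not_implyP[ip /negP]]; rewrite -ltnNge => iD.
have iE : d 1%g (vertex p i) = i.
  by have := geodesic_vertex_dist hS gp (leq0n i) ip; rewrite vertex0 sp subn0.
have iK : (K <= i)%N.
  have := word_dist_triangle hS (vertex p i) 1%g (g^-1)%g.
  by rewrite (word_distC hS (vertex p i)); lia.
have h1 := floyd_dist_geodesic_tail hS lam01 gp ip; rewrite sp tp in h1.
have h2 := floyd_dist_near hS lam01 1%g (ltnW iD); rewrite d1V in h2.
have h3 : fd 1%g (g^-1)%g (vertex p i) < r / 2.
  rewrite -(ltr_pM2r (lamX_gt0 D)); apply: (le_lt_trans h2).
  have /= := hN (d 1%g g) ltac:(rewrite /=; lia).
  rewrite ltr_pdivlMr // mulrC; apply: le_lt_trans.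
  by rewrite ler_wpM2r ?ler_nat // ltW.
have := tri (vertex p i) 1%g (g^-1)%g h; have := hK _ iK => /=; lra.
Unshelve. all: by end_near.
Qed.

Lemma boundary_north_south e r : 0 < e -> 0 < r -> exists M, forall g z z' u,
  (M <= d 1%g g)%N -> represents (inr z : FC) u ->
  represents (inr z' : FC) (fun n => g * u n)%g ->
  r < cd 1%g (inl (g^-1)%g) (inr z) -> cd 1%g (inl g) (inr z') <= e.
Proof.
move=> e0 r0; have [M hM] := floyd_north_south e0 r0.
exists M => g z z' u gM zu zu' h.
apply: (floyd_cdist_le hS lam01 (represents_vertex hS lam01 g) zu').
apply: filterS (floyd_cdist_gt hS lam01 (represents_vertex hS lam01 _) zu h).
by move=> n /ltW; apply: hM.
Qed.

Section FloydMap.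
Variables (X : metricType R) (act : G -> X -> X) (F : FB -> X).
Hypothesis X_compact : compact [set: X].
Hypothesis act_homeo : action_by_homeomorphisms act.
Hypothesis hF : floyd_map act F.

Let act1 x : act 1%g x = x. Proof. by case: act_homeo. Qed.
Let actM g h x : act (g * h)%g x = act g (act h x). Proof. by case: act_homeo. Qed.

Definition proper_stabilizer (x : X) : Prop :=
  forall K : set X, compact K -> K `<=` [set~ x] ->
    finite_set (stabilizer act x `&` [set g | (act g @` K) `&` K !=set0]).

Let F_continuous z (W : set X) : nbhs (F z) W ->
  exists2 e, 0 < e & forall z', cd 1%g (inr z) (inr z') < e -> W (F z').
Proof. by case: hF => h _ _; apply: h. Qed.

Let F_lift g (x : X) : exists z z' u, [/\ F z = x, F z' = act g x,
  represents (inr z : FC) u & represents (inr z' : FC) (fun n => g * u n)%g].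
Proof.
case: hF => _ heq /(_ x)[z zx]; exists z.
have zu := represents_approx hS lam01 (inr z : FC).
have [z' zu'] := represents_trans hS lam01 g zu.
exists z', (Defs.approx (inr z)); split=> //; rewrite -zx; apply: heq.
by exists (Defs.approx (inr z)); apply/represents_boundary.
Qed.

(** The same dynamics on [X], uniformly away from the repelling point [F b]. It
    is stated along a filter because the attracting and repelling points exist
    only as limits. *)
Lemma contracting_eventually (T : Type) (U : set_system T) (g : T -> G) z b
    (V W : set X) : Filter U ->
  (forall M, U [set t | (M <= d 1%g (g t))%N]) ->
  (forall e, 0 < e -> U [set t | cd 1%g (inl (g t)) (inr z) < e]) ->
  (forall e, 0 < e -> U [set t | cd 1%g (inl (g t)^-1%g) (inr b) < e]) ->
  nbhs (F b) V -> nbhs (F z) W ->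
  U [set t | forall x, ~ V x -> W (act (g t) x)].
Proof.
move=> UF far gz gb /F_continuous[r r0 hV] /F_continuous[e e0 hW].
have e4 : 0 < e / 4 by lra. have r4 : 0 < r / 4 by lra.
have [M hM] := boundary_north_south e4 r4.
have r2 : 0 < r / 2 by lra. have e2 : 0 < e / 2 by lra.
apply: filterS (filterI (far M) (filterI (gz _ e2) (gb _ r2))).
move=> t /= [t1 [t2 t3]] x Vx; have [y [y' [u [yx yx' yu yu']]]] := F_lift (g t) x.
rewrite -yx'; apply: hW; rewrite -yx in Vx.
have h1 : r <= cd 1%g (inr b) (inr y).
  by rewrite leNgt; apply/negP => /hV.
have h2 := floyd_cdist_triangle hS lam01 (inl (g t)^-1%g) 1%g (inr b) (inr y).
rewrite (floyd_cdistC hS lam01 _ (inr b) (inl _)) in h2.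
have h3 : r / 4 < cd 1%g (inl (g t)^-1%g) (inr y) by lra.
have h4 := hM _ _ _ _ t1 yu yu' h3.
have h5 := floyd_cdist_triangle hS lam01 (inl (g t)) 1%g (inr z) (inr y').
by rewrite (floyd_cdistC hS lam01 _ (inr z) (inl _)) in h5; lra.
Qed.

Hypothesis X_third : forall x y : X, exists t, t <> x /\ t <> y.

(** If [q] stayed away from [F z], the contracting dynamics would make [g] map
    the complement of a small neighbourhood of [q] into a proper part of it;
    by properness [g] would then be of finite order, which is absurd. *)
Lemma fixed_point_near z (W : set X) : nbhs (F z) W -> exists2 e, 0 < e &
  forall g q, proper_stabilizer q -> act g q = q ->
    cd 1%g (inl g) (inr z) < e -> W q.
Proof.
move=> zW; apply: contrapT => nh.
have /choice[gq gqP] : forall n : nat, exists t : G * X, [/\ proper_stabilizer t.2,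
    act t.1 t.2 = t.2, cd 1%g (inl t.1) (inr z) < n.+1%:R^-1 & ~ W t.2].
  move=> n; apply: contrapT => nt; apply: nh; exists n.+1%:R^-1.
    by rewrite invr_gt0 ltr0Sn.
  by move=> g q h1 h2 h3; apply: contrapT => h4; apply: nt; exists (g, q).
have [U [UU ooU]] := @ultraFilterLemma nat \oo _.
have gz e : 0 < e -> U [set n | cd 1%g (inl (gq n).1) (inr z) < e].
  move=> e0; apply: ooU; apply: filterS (near_infty_natSinv_lt (PosNum e0)) => n /=.
  by apply: lt_trans; case: (gqP n).
have far M : U [set n | (M <= d 1%g (gq n).1)%N].
  apply: filterS (gz _ (lamX_gt0 M)) => n /=.
  move=> /(le_lt_trans (floyd_cdist_boundary_ge hS lam01 _ _ _)).
  rewrite leqNgt; apply: contraL => nM; rewrite -leNgt.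
  by case/andP: lam01 => l0 l1; apply: ler_wiXn2l; [exact: ltW|exact: ltW|exact: ltnW].
have farV M : U [set n | (M <= d 1%g (gq n).1^-1%g)%N].
  apply: filterS (far M) => n /=.
  rewrite -(word_dist_trans hS (gq n).1 1%g (gq n).1^-1%g) mulg1 mulgV.
  by rewrite (word_distC hS (gq n).1).
have [b gb] := floyd_boundary_limit hS lam01 UU farV.
(* [g n] contracts towards [F z]; since [q n] is fixed and not near [F z], it
   has to approach the repelling point [F b]. *)
have contr V W' : nbhs (F b) V -> nbhs (F z) W' ->
    U [set n | forall x, ~ V x -> W' (act (gq n).1 x)].
  exact: contracting_eventually.
have qb V : nbhs (F b) V -> U [set n | V (gq n).2].
  move=> bV; apply: filterS (contr V W bV zW) => n /= h.
  by apply: contrapT => /h; case: (gqP n) => _ -> _.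
have zb : F z <> F b.
  move=> zb; have := qb W; rewrite -zb => /(_ zW)/filter_ex[n /=].
  by case: (gqP n).
(* The set [K] avoids [q], is mapped into its part [W'] by [g], and contains a
   point [t] outside this part. *)
have [t [tz tb]] := X_third (F z) (F b).
have hX := @metric_hausdorff R X.
have [A [B [oA oB Az Bb AB]]] := hausdorff_separation hX zb.
have [A' [B' [oA' oB' At B'z AB']]] := hausdorff_separation hX tz.
have [A2 [B2 [oA2 oB2 A2t B2b AB2]]] := hausdorff_separation hX tb.
pose V := B `&` B2; pose W' := A `&` B'; pose K := ~` V.
have bV : nbhs (F b) V by apply: open_nbhs_nbhs; split; [exact: openI|].
have zW' : nbhs (F z) W' by apply: open_nbhs_nbhs; split; [exact: openI|].
have W'K : W' `<=` K by move=> x [Ax _] [Bx _]; have : (A `&` B) x by []; rewrite AB.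
have Kt : K t by move=> [_ B2t]; have : (A2 `&` B2) t by []; rewrite AB2.
have nW't : ~ W' t by move=> [_ B't]; have : (A' `&` B') t by []; rewrite AB'.
have cK : compact K.
  apply: (subclosed_compact _ X_compact) => //; apply: open_closedC; exact: openI.
have [n [/= nq nK]] := filter_ex (filterI (qb V bV) (contr V W' bV zW')).
have [qp gq_fix _ _] := gqP n; set g := (gq n).1 in nK gq_fix.
set q := (gq n).2 in nq qp gq_fix.
have gK j x : K x -> W' (act (g ^+ j.+1)%g x).
  elim: j => [|j IH] Kx; first by rewrite expg1; apply: nK.
  by rewrite expgS actM; apply: nK; apply: W'K; apply: IH.
have gq_ j : act (g ^+ j)%g q = q.
  by elim: j => [|j IH]; rewrite ?expg0 // expgS actM IH.
have fin := qp K cK (_ : K `<=` [set~ q]).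
have powers i j : (i < j)%N -> (g ^+ i.+1 <> g ^+ j.+1)%g.
  move=> ij gij; have : (g ^+ (j - i))%g = 1%g.
    apply: (mulgI (g ^+ i.+1)%g); rewrite -expgnDr mulg1 gij; congr (g ^+ _)%g.
    lia.
  case E : (j - i)%N => [|k]; first by lia.
  by move=> gk; apply: nW't; have := gK k t Kt; rewrite gk act1.
apply: infinite_nat; rewrite -(_ : (fun j => (g ^+ j.+1)%g) @^-1`
    (stabilizer act q `&` [set g | (act g @` K) `&` K !=set0]) = setT).
  apply: finite_preimage; last by apply: fin => x Kx /= xq; apply: Kx; rewrite xq.
  by move=> i j _ _ ij; case: (ltngtP i j) => // /powers; rewrite ij.
apply/seteqP; split=> // j _; split; first exact: gq_.
exists (act (g ^+ j.+1)%g t); split; last by apply/W'K/gK.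
by exists t.
Qed.

Lemma proper_stabilizer_act a x : proper_stabilizer x -> proper_stabilizer (act a x).
Proof.
move=> hx K cK Kx; pose K' := act a^-1%g @` K.
have cont h : continuous (act h) by case: act_homeo.
have cK' : compact K'.
  by apply: continuous_compact => //; apply: continuous_subspaceT; apply: cont.
have K'x : K' `<=` [set~ x].
  by move=> _ [y Ky <-] /= yx; apply: (Kx y Ky); rewrite /= -yx -actM mulgV act1.
apply: sub_finite_set (finite_image (fun h => a * h * a^-1)%g (hx K' cK' K'x)).
move=> g [gx [_ [[y Ky <-] Kgy]]]; exists (a^-1 * g * a)%g; last first.
  by rewrite !mulgA mulgV mul1g -mulgA mulgV mulg1.
split; first by rewrite /stabilizer /= !actM gx -actM mulVg act1.
exists (act a^-1%g (act g y)); split; last by exists (act g y).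
by exists (act a^-1%g y); [exists y | rewrite -!actM -!mulgA mulgV mulg1].
Qed.

Variable o : G.

(** Elements [x * y^-1] with [x], [y] in the coset [a P], [P] the stabilizer
    of [xi], fix [act a xi]; one of them is at bounded distance from [u], so
    [fixed_point_near] applies. *)
Lemma coset_point_near z (W : set X) (eps : R) D : nbhs (F z) W ->
  exists2 e, 0 < e & forall (a : G) xi (u y : G),
    proper_stabilizer xi ->
    ((fun p => a * p)%g @` stabilizer act xi) y -> (d o y <= D)%N ->
    nbhd S eps ((fun p => a * p)%g @` stabilizer act xi) u ->
    cd o (inl u) (inr z) < e -> W (act a xi).
Proof.
move=> /fixed_point_near[e e0 he].
(* [u] is within [B] of [x * y^-1], and the lower bound on the distance from
   [u] to [z] absorbs the Floyd length of a path of [B] edges at [u]. *)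
pose E := Num.truncn eps; pose B := (E + d 1%g o + D)%N.
pose c : R := B%:R / lam ^+ B + 1.
have c0 : 0 < c by rewrite /c ltr_wpDl // divr_ge0 // ltW.
exists (e / c * lam ^+ d 1%g o); first by rewrite mulr_gt0 // divr_gt0.
move=> a xi u y /proper_stabilizer_act ha [p' p'xi yE] oy [x [p pxi xE] ux] uz.
apply: (he (x * y^-1)%g _ (ha a)).
  have p'V : act p'^-1%g xi = xi by rewrite -{1}p'xi -actM mulVg act1.
  rewrite -xE -yE /= -actM invgM !mulgA -!mulgA mulVg mulg1 !actM.
  by rewrite p'V pxi.
have uxE : (d u x <= E)%N by rewrite truncn_ge_nat // (le_trans _ ux).
have uB : (d u (x * y^-1)%g <= B)%N.
  have := word_dist_triangle hS x u (x * y^-1)%g.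
  have := word_dist_triangle hS o 1%g y.
  have -> : d x (x * y^-1)%g = d 1%g (y^-1)%g.
    by rewrite -(word_dist_trans hS x 1%g) mulg1.
  have -> : d 1%g (y^-1)%g = d 1%g y.
    by rewrite -(word_dist_trans hS y) mulg1 mulgV word_distC.
  by rewrite /B; lia.
have h1 := floyd_dist_near hS lam01 1%g uB.
have h2 := floyd_cdist_boundary_ge hS lam01 1%g u z.
have h3 : cd 1%g (inl u) (inr z) < e / c.
  rewrite -(ltr_pM2r (lamX_gt0 (d 1%g o))); apply: le_lt_trans uz.
  exact: floyd_cdist_base.
apply: le_lt_trans (floyd_cdist_triangle hS lam01 (inl u) _ _ _) _.
rewrite floyd_cdist_vertex // fdC.
have h4 : fd 1%g u (x * y^-1)%g <= B%:R / lam ^+ B * cd 1%g (inl u) (inr z).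
  rewrite mulrAC ler_pdivlMr //; apply: (le_trans h1); exact: ler_wpM2l.
apply: (@le_lt_trans _ _ (c * cd 1%g (inl u) (inr z))).
  by rewrite /c mulrDl mul1r lerD2r.
by rewrite mulrC -ltr_pdivlMr.
Qed.

(** Otherwise the parabolic point of the horosphere would lie in two disjoint
    neighbourhoods, one of [F z] and one of [F z']. *)
Lemma coset_not_near_both z z' (eps : R) D : F z <> F z' ->
  exists2 e, 0 < e & forall (a : G) xi (u u' y : G),
    proper_stabilizer xi ->
    ((fun p => a * p)%g @` stabilizer act xi) y -> (d o y <= D)%N ->
    nbhd S eps ((fun p => a * p)%g @` stabilizer act xi) u ->
    nbhd S eps ((fun p => a * p)%g @` stabilizer act xi) u' ->
    cd o (inl u) (inr z) < e -> cd o (inl u') (inr z') < e -> False.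
Proof.
move=> /(hausdorff_separation (@metric_hausdorff R X))[A [B [oA oB Az Bz AB]]].
have zA : nbhs (F z) A by apply: open_nbhs_nbhs.
have zB : nbhs (F z') B by apply: open_nbhs_nbhs.
have [e e0 he] := coset_point_near eps D zA.
have [e' e'0 he'] := coset_point_near eps D zB.
exists (Num.min e e'); first by rewrite lt_min e0.
move=> a xi u u' y hxi Yy oy Yu Yu'; rewrite !lt_min => /andP[h1 _] /andP[_ h2].
have : (A `&` B) (act a xi) by split; [exact: (he a xi u y)|exact: (he' a xi u' y)].
by rewrite AB.
Qed.

End FloydMap.
End Dynamics.

(** If [X] had two points, the infinite stabilizer of one of them would fix the
    other one as well, against properness. *)
Lemma parabolic_third_point (R : realType) (G : groupType) (X : metricType R)
  (act : G -> X -> X) (q : X) :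
  action_by_homeomorphisms act -> ~ (exists x, forall g, act g x = x) ->
  bounded_parabolic act q -> forall x y : X, exists t, t <> x /\ t <> y.
Proof.
move=> [act1 actM _] nofix [infq propq _] x y; apply: contrapT => nt.
have xy t : t = x \/ t = y.
  by apply: contrapT => /not_orP[? ?]; apply: nt; exists t.
have [t tq] : exists t, t <> q.
  apply: contrapT => /forallNP h; apply: nofix; exists q => g.
  exact: contrapT (h _).
have all_qt s : s <> q -> s = t.
  by move=> sq; have [] := xy s; have [] := xy t; have [] := xy q; congruence.
apply: infq; apply: sub_finite_set (propq [set t] _ _).
- move=> g gq; split=> //; exists t; split=> //; exists t => //; apply: all_qt.
  by move=> gt; apply: tq; rewrite -[t]act1 -[q]act1 -(mulVg g) !actM gt gq.
- exact: compact_set1.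
- by move=> _ ->.
Qed.

(** * Shortcut distances and horospheres *)

Section Shortcuts.
Variables (R : realType) (G : groupType) (S : {fset G}).
Hypothesis hS : symmetric_generating_set S.
Variable lam : R.
Hypothesis lam01 : 0 < lam < 1.
Variables (X : metricType R) (F : floyd_boundary S lam -> X).

Local Notation d := (word_dist S).
Local Notation fd := (floyd_dist S lam).
Local Notation FB := (floyd_boundary S lam).
Local Notation FC := (floyd_completion S lam).
Local Notation cd := (@floyd_cdist R G S lam).

Let lam_gt0 : 0 < lam. Proof. by case/andP: lam01. Qed.
Let lamX_gt0 n : 0 < lam ^+ n. Proof. exact: exprn_gt0. Qed.

Lemma inf_ge0 (A : set R) : (forall x, A x -> 0 <= x) -> 0 <= inf A.
Proof.
move=> h; have [[x Ax]|/nonemptyPn ->] := pselect (A !=set0); last by rewrite inf0.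
by apply: lb_le_inf; [exists x|].
Qed.

(** The chains over which the shortcut metric is an infimum, with [n] jumps
    inside fibres of [F]. *)
Definition chain n (xi eta : nat -> FC) : Prop :=
  forall i, (i < n)%N -> omega F (eta i) (xi i.+1).

Definition chain_length o n (xi eta : nat -> FC) : R :=
  \sum_(i < n.+1) cd o (xi i) (eta i).

Lemma shortcut_dist_le o n xi eta : chain n xi eta ->
  shortcut_dist F o (floyd_map_ext F (xi 0%N)) (floyd_map_ext F (eta n)) <=
    chain_length o n xi eta.
Proof.
move=> ch.
have pge0 x y : 0 <= shortcut_predist F o x y.
  apply: inf_ge0 => _ [m [a [b [_ _ _ ->]]]].
  by apply: sumr_ge0 => i _; apply: floyd_cdist_ge0.
apply: (@le_trans _ _ (shortcut_predist F o (xi 0%N) (eta n))).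
  apply: ge_inf; last by exists (xi 0%N), (eta n).
  by exists 0 => _ [x [y [_ _ ->]]].
apply: ge_inf; last by exists n, xi, eta.
exists 0 => _ [m [a [b [_ _ _ ->]]]].
by apply: sumr_ge0 => i _; apply: floyd_cdist_ge0.
Qed.

Lemma shortcut_dist_chain o (x y : X) e : (forall x, exists z, F z = x) -> 0 < e ->
  exists n xi eta, [/\ chain n xi eta, floyd_map_ext F (xi 0%N) = inr x,
    floyd_map_ext F (eta n) = inr y &
    chain_length o n xi eta < shortcut_dist F o (inr x) (inr y) + e].
Proof.
move=> Fs e0; have e2 : 0 < e / 2 by lra.
have [zx zxE] := Fs x; have [zy zyE] := Fs y.
have [_ [x' [y' [x'E y'E ->]]] h1] : exists2 r, [set r | exists x' y',
    [/\ floyd_map_ext F x' = inr x, floyd_map_ext F y' = inr y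
      & r = shortcut_predist F o x' y']] r & r < shortcut_dist F o (inr x) (inr y) + e.
  apply: inf_lt; last by rewrite ltrDl.
  exists (shortcut_predist F o (inr zx) (inr zy)), (inr zx), (inr zy).
  by split=> //=; rewrite ?zxE ?zyE.
case: x' x'E h1 => // zx' zx'E; case: y' y'E => // zy' zy'E h1.
have [_ [n [xi [eta [xiE etaE ch ->]]]] h2] : exists2 r, [set r |
    exists n (xi eta : nat -> floyd_completion S lam),
    [/\ xi 0%N = inr zx', eta n = inr zy',
        forall i, (i < n)%N -> omega F (eta i) (xi i.+1)
      & r = \sum_(i < n.+1) cd o (xi i) (eta i)]] r &
    r < shortcut_dist F o (inr x) (inr y) + e.
  apply: inf_lt h1.
  exists (cd o (inr zx') (inr zy')), 0%N, (fun=> inr zx'), (fun=> inr zy').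
  by split=> //; rewrite big_ord1.
by exists n, xi, eta; split; rewrite // ?xiE ?etaE.
Qed.

Lemma shortcut_dist_via o g h z z' : F z = F z' ->
  shortcut_dist F o (inl g) (inl h) <= cd o (inl g) (inr z) + cd o (inr z') (inl h).
Proof.
move=> zz'; have /= := @shortcut_dist_le o 1
  (fun i => if i is 0%N then inl g else inr z')
  (fun i => if i is 0%N then inr z else inl h).
rewrite /chain_length big_ord_recl big_ord1 /=; apply=> -[|i] // _.
by exists z, z'.
Qed.

Lemma boundary_far o g (z : FB) M : cd o (inl g) (inr z) < lam ^+ M ->
  (M <= d o g)%N.
Proof.
move=> h; have := le_lt_trans (floyd_cdist_boundary_ge hS lam01 o g z) h.
rewrite leqNgt; apply: contraL => gM; rewrite -leNgt.
by case/andP: lam01 => l0 l1; apply: ler_wiXn2l; [exact: ltW|exact: ltW|exact: ltnW].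
Qed.

Lemma represents_far o (z : FB) u M : represents (inr z : FC) u ->
  \forall n \near \oo, (M <= d o (u n))%N.
Proof.
move=> zu; apply: filterS (represents_cvg hS lam01 o zu (lamX_gt0 M)) => n.
exact: boundary_far.
Qed.

Variables (PP : set (set G)) (eps : R) (o : G).
Hypothesis hvis : forall r, 0 < r -> exists2 kappa, 0 < kappa &
  forall (p : epath G) (v : G), geodesic S p -> (0 < word_length p)%N ->
    transition_point S PP eps r p v ->
    kappa < shortcut_dist F v (inl (source p)) (inl (target p)).

(** A geodesic between approximations of the two points of the fibre passes near
    [o] by Karlsson's lemma, and its vertex nearest to [o] sees the endpoints at
    a small shortcut distance. By visibility this vertex is deep in a
    horosphere, which the geodesic then follows for a long time in both
    directions. *)
Lemma fibre_horosphere z z' : F z = F z' -> 0 < cd o (inr z) (inr z') ->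
  exists D, forall e, 0 < e -> exists Y u v,
    [/\ PP Y, exists2 y, Y y & (d o y <= D)%N, nbhd S eps Y u, nbhd S eps Y v &
        cd o (inl u) (inr z) < e /\ cd o (inl v) (inr z') < e].
Proof.
move=> zz' c0; set c := cd o _ _ in c0; pose mu := decay_rate lam.
have m0 := decay_rate_gt0 lam01; have m1 := decay_rate_lt1 lam01.
have mX i j : (i <= j)%N -> mu ^+ j / (1 - mu) <= mu ^+ i / (1 - mu).
  move=> ij; apply: ler_wpM2r; first by rewrite invr_ge0 subr_ge0 ltW.
  by apply: ler_wiXn2l => //; apply: ltW.
(* Geodesics staying at distance [K] from [o] are too short to join
   approximations of [z] and [z']. *)
near \oo => K.
have cK : mu ^+ K / (1 - mu) < c / 4.
  by near: K; apply: (decay_rate_cvg lam01); lra.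
exists (K + Num.truncn eps)%N => e e0; near \oo => R0.
have eR : mu ^+ R0 / (1 - mu) < e / 2.
  by near: R0; apply: (decay_rate_cvg lam01); lra.
have R0_gt0 : (0 < R0)%N by near: R0; apply: nbhs_infty_gt.
have R0r : (0 : R) < R0%:R by rewrite ltr0n.
have [kappa k0 hk] := hvis R0r.
have zu := represents_approx hS lam01 (inr z : FC).
have zv := represents_approx hS lam01 (inr z' : FC).
set u := Defs.approx _ in zu; set v := Defs.approx _ in zv.
(* Changing the base point from [o] to a vertex at distance at most [K] costs
   a factor [lam ^+ K]. *)
have kl0 : 0 < kappa / 2 * lam ^+ K by rewrite mulr_gt0 //; lra.
have e2 : 0 < e / 2 by lra.
near \oo => n.
have uv : c / 2 < fd o (u n) (v n).
  by near: n; apply: (floyd_cdist_gt hS lam01 zu zv); rewrite -/c; lra.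
have uk : cd o (inl (u n)) (inr z) < kappa / 2 * lam ^+ K.
  by near: n; apply: (represents_cvg hS lam01).
have vk : cd o (inl (v n)) (inr z') < kappa / 2 * lam ^+ K.
  by near: n; apply: (represents_cvg hS lam01).
have ue : cd o (inl (u n)) (inr z) < e / 2.
  by near: n; apply: (represents_cvg hS lam01).
have ve : cd o (inl (v n)) (inr z') < e / 2.
  by near: n; apply: (represents_cvg hS lam01).
have ufar : (K + R0 <= d o (u n))%N by near: n; apply: represents_far zu.
have vfar : (K + R0 <= d o (v n))%N by near: n; apply: represents_far zv.
have [p pp lp] := geodesic_exists hS (u n) (v n).
have gp := geodesicP pp lp; have [_ sp tp] := pp.
have [i0 i0p i0min] := nearest_vertex S o p; set w := vertex p i0 in i0min.
have wK : (d o w <= K)%N.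
  rewrite leqNgt; apply/negP => Kw.
  have := floyd_dist_karlsson hS lam01 gp (fun i ip => leq_trans (ltnW Kw) (i0min i ip)).
  by rewrite sp tp -/mu; lra.
have wu : d w (u n) = i0.
  have := geodesic_vertex_dist hS gp (leq0n i0) i0p.
  by rewrite vertex0 sp subn0 word_distC.
have wv : d w (v n) = (word_length p - i0)%N.
  by have := geodesic_vertex_dist hS gp i0p (leqnn _); rewrite vertex_last tp.
have i0R : (R0 <= i0)%N.
  move: (word_dist_triangle hS w o (u n)) ufar wK; rewrite wu.
  by clear; lia.
have i0R' : (i0 + R0 <= word_length p)%N.
  move: (word_dist_triangle hS w o (v n)) vfar wK i0p; rewrite wv.
  by clear; lia.
have ip1 : (i0 - R0 <= word_length p)%N by apply: leq_trans i0p; apply: leq_subr.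
have p_gt0 : (0 < word_length p)%N by apply: leq_trans i0R'; rewrite addn_gt0 R0_gt0 orbT.
have [Y PPY Yw] : exists2 Y, PP Y & deep S eps R0%:R Y p w.
  apply: contrapT => nY; have /hk : transition_point S PP eps R0%:R p w.
    by split; [exact: mem_vertex | move=> Y PY Yp; apply: nY; exists Y].
  move=> /(_ gp p_gt0); rewrite sp tp.
  have cdw x y : cd w x y * lam ^+ K <= cd o x y.
    apply: le_trans (floyd_cdist_base hS lam01 w o x y).
    rewrite ler_wpM2l ?floyd_cdist_ge0 // word_distC //.
    by case/andP: lam01 => l0 l1; apply: ler_wiXn2l => //; apply: ltW.
  have := shortcut_dist_via w (u n) (v n) zz'.
  rewrite (floyd_cdistC hS lam01 _ (inr z')).
  have := le_lt_trans (cdw _ _) uk; rewrite ltr_pM2r //.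
  have := le_lt_trans (cdw _ _) vk; rewrite ltr_pM2r //; lra.
have Ywn i : (i <= word_length p)%N -> (d w (vertex p i) <= R0)%N ->
    nbhd S eps Y (vertex p i).
  by move=> ip iR; apply: Yw; [exact: mem_vertex | rewrite ler_nat].
exists Y, (vertex p (i0 - R0)), (vertex p (i0 + R0)); split=> //.
- have [|y Yy wy] := Ywn i0 i0p; first by rewrite word_dist0.
  exists y => //; have yE : (d w y <= Num.truncn eps)%N.
    by rewrite truncn_ge_nat // (le_trans _ wy).
  by apply: leq_trans (word_dist_triangle hS w o y) _; apply: leq_add.
- apply: Ywn => //.
  by rewrite word_distC // geodesic_vertex_dist ?leq_subr // subKn.
- by apply: Ywn => //; rewrite geodesic_vertex_dist ?leq_addr // addKn.
split; apply: le_lt_trans.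
- exact: (floyd_cdist_triangle hS lam01 (inl (u n))).
- rewrite floyd_cdist_vertex // floyd_distC // -sp.
  have := floyd_dist_before_nearest hS lam01 gp i0p i0min (leq_subr R0 i0).
  rewrite subKn //; have := mX R0 (d o w + R0)%N (leq_addl _ _).
  by rewrite -/mu -/w sp; lra.
- exact: (floyd_cdist_triangle hS lam01 (inl (v n))).
- rewrite floyd_cdist_vertex // -tp.
  have := floyd_dist_after_nearest hS lam01 gp i0p i0min (leq_addr R0 i0) i0R'.
  rewrite addKn; have := mX R0 (d o w + R0)%N (leq_addl _ _).
  by rewrite -/mu -/w tp; lra.
Unshelve. all: by end_near.
Qed.

End Shortcuts.

(** * Chains between boundary points *)

(** Used both for omitting a trivial jump of a chain and for merging two
    consecutive paths. *)
Lemma ler_sum_merge (R : realType) (f f' : nat -> R) (c : R) n i : (i <= n)%N ->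
  (forall k, (k < i)%N -> f' k <= f k) ->
  (forall k, (i < k)%N -> (k <= n)%N -> f' k <= f k.+1) ->
  f' i <= f i + f i.+1 + c ->
  \sum_(k < n.+1) f' k <= \sum_(k < n.+2) f k + c.
Proof.
move=> i_n lt_i gt_i eq_i; rewrite -!(big_mkord xpredT).
rewrite (@big_cat_nat _ _ _ i) //= 1?ltnW // [X in _ + X <= _]big_ltn //.
rewrite [X in _ <= X + _](@big_cat_nat _ _ _ i) //= ?(leq_trans i_n) ?leqW //.
rewrite [X in _ <= _ + X + _]big_ltn ?ltnS ?leqW // [X in _ <= _ + (_ + X) + _]big_ltn //.
rewrite (_ : forall x y z t, x + (y + (z + t)) + c = x + ((y + z + c) + t)); last first.
  by move=> x y z t; ring.
apply: lerD; first by rewrite !big_mkord; apply: ler_sum => k _; apply: lt_i.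
apply: lerD => //; rewrite [leRHS]big_add1 /=.
rewrite big_nat_cond [leRHS]big_nat_cond; apply: ler_sum => k.
by rewrite andbT ltnS => /andP[]; apply: gt_i.
Qed.

(** Used for shortening a chain that visits a fibre twice. *)
Lemma ler_sum_remove (R : realType) (f : nat -> R) n i j :
  (forall k, 0 <= f k) -> (i <= j)%N -> (j <= n)%N ->
  \sum_(k < (n - (j - i)).+1) f (if (k <= i)%N then k : nat else (k + (j - i))%N) <=
    \sum_(k < n.+1) f k.
Proof.
move=> f0 ij jn; rewrite -(big_mkord xpredT f).
rewrite -(big_mkord xpredT (fun k => f (if (k <= i)%N then k else (k + (j - i))%N))).
rewrite (@big_cat_nat _ _ _ i.+1) //=; last by lia.
rewrite [leRHS](@big_cat_nat _ _ _ i.+1) //=; last by lia.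
rewrite [X in _ <= _ + X](@big_cat_nat _ _ _ j.+1) //=.
have e1 : \sum_(0 <= k < i.+1) f (if (k <= i)%N then k else (k + (j - i))%N) =
    \sum_(0 <= k < i.+1) f k.
  by apply: eq_big_nat => k /andP[_]; rewrite ltnS => ->.
have e2 : \sum_(i.+1 <= k < (n - (j - i)).+1)
    f (if (k <= i)%N then k else (k + (j - i))%N) = \sum_(j.+1 <= k < n.+1) f k.
  rewrite (_ : j.+1 = (i.+1 + (j - i))%N) ?big_addn; last by lia.
  rewrite (_ : n.+1 - (j - i) = (n - (j - i)).+1)%N; last by lia.
  by apply: eq_big_nat => k /andP[ik _]; rewrite leqNgt ik.
by rewrite e1 e2 lerD2l lerDr; apply: sumr_ge0.
Qed.

Section Chains.
Variables (R : realType) (G : groupType) (S : {fset G}).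
Hypothesis hS : symmetric_generating_set S.
Variable lam : R.
Hypothesis lam01 : 0 < lam < 1.
Variables (X : metricType R) (F : floyd_boundary S lam -> X).
Hypothesis F_surj : forall x, exists z, F z = x.
Variable o : G.

Local Notation d := (word_dist S).
Local Notation fd := (floyd_dist S lam).
Local Notation FB := (floyd_boundary S lam).
Local Notation FC := (floyd_completion S lam).
Local Notation cd := (@floyd_cdist R G S lam).
Implicit Types (a b : nat -> FB) (n i j k : nat) (z : FB).

Definition boundary_chain z z' n a b : Prop :=
  [/\ a 0%N = z, b n = z' & forall i, (i < n)%N -> F (b i) = F (a i.+1)].

Definition boundary_length n a b : R :=
  \sum_(i < n.+1) cd o (inr (a i)) (inr (b i)).

(** An almost optimal chain starts and ends somewhere in the fibres of [z] and
    [z']; two more jumps, at no cost, lead to [z] and [z'] themselves. *)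
Lemma boundary_chain_exists z z' e : 0 < e -> exists n a b,
  boundary_chain z z' n a b /\
  boundary_length n a b < shortcut_dist F o (inr (F z)) (inr (F z')) + e.
Proof.
move=> e0.
have [n [xi [eta [ch x0 yn len]]]] := shortcut_dist_chain o (F z) (F z') F_surj e0.
have /choice[a aP] : forall i, exists t : FB, (i <= n)%N -> xi i = inr t.
  move=> i; have [ip|?] := leqP i n; last by exists z.
  case: i ip => [|i] ip; last by have [t [t' [_ -> _]]] := ch _ ip; exists t'.
  by case: (xi 0%N) x0 => // t _; exists t.
have /choice[b bP] : forall i, exists t : FB, (i <= n)%N -> eta i = inr t.
  move=> i; case: (ltngtP i n) => [ip|?|->]; last 2 first.
  - by exists z.
  - by case: (eta n) yn => // t _; exists t.
  - by have [t [t' [-> _ _]]] := ch _ ip; exists t.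
have Fa0 : F (a 0%N) = F z by move: x0; rewrite aP // => -[].
have Fbn : F (b n) = F z' by move: yn; rewrite bP // => -[].
pose ext c i := if i is j.+1 then if (j <= n)%N then c j else z' else z.
exists n.+2, (ext a), (ext b); split; last first.
  apply: le_lt_trans len; rewrite /boundary_length big_ord_recl big_ord_recr /=.
  rewrite ltnn !floyd_cdist0 // add0r addr0.
  apply: ler_sum => i _; have i_n : (i <= n)%N by rewrite -ltnS.
  by rewrite /= i_n aP // bP.
split=> //=; first by rewrite ltnn.
move=> [|i]; first by rewrite /= Fa0.
rewrite /= !ltnS => i_n; rewrite i_n; case: ltngtP i_n => // [i_n _|-> _]; last by rewrite Fbn.
have [t [t' [bt at' tt']]] := ch i i_n.
by move: bt at'; rewrite aP // bP 1?ltnW // => -[->] [->].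
Qed.

Definition reduced n a b : Prop :=
  (forall i j, (i < n)%N -> (j < n)%N -> F (b i) = F (b j) -> i = j) /\
  (forall i, (i < n)%N -> 0 < cd o (inr (b i)) (inr (a i.+1))).

(** Two jumps in the same fibre can be replaced by a single one, and a jump of
    length zero can be omitted by the triangle inequality. *)
Lemma boundary_chain_reduce z z' n a b : boundary_chain z z' n a b ->
  exists n' a' b', [/\ boundary_chain z z' n' a' b', reduced n' a' b' &
    boundary_length n' a' b' <= boundary_length n a b].
Proof.
have [m] := ubnP n; elim: m n a b => // m IH n a b /ltnSE nm ch.
have [red|/not_andP[|]] := pselect (reduced n a b); first by exists n, a, b.
  move=> nr; have [i [j [ij jn Fij]]] : exists i j, [/\ (i < j)%N, (j < n)%N & F (b i) = F (b j)].
    apply: contrapT => h; apply: nr => i j i_n jn Fij.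
    case: (ltngtP i j) => // ij; case: h; [exists i, j|exists j, i]; by split.
  pose phi k := if (k <= i)%N then k else (k + (j - i))%N.
  have ch2 : boundary_chain z z' (n - (j - i)) (a \o phi) (b \o phi).
    case: ch => a0 bn ab; split; rewrite /= /phi //.
      by rewrite leqNgt (_ : (i < _)%N) ?subnK //; lia.
    move=> k kn; case: (ltngtP k i) => ki.
    - by apply: ab; lia.
    - rewrite ab; last by lia.
      by rewrite addSn.
    - rewrite ki Fij ab //; congr (F (a _)); lia.
  have lt_m : (n - (j - i) < m)%N by lia.
  have [n' [a' [b' [ch' red' len']]]] := IH _ _ _ lt_m ch2.
  exists n', a', b'; split=> //; apply: (le_trans len').
  apply: (@ler_sum_remove _ (fun k => cd o (inr (a k)) (inr (b k)))).
  - by move=> k; apply: floyd_cdist_ge0.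
  - exact: ltnW.
  - exact: ltnW.
move=> /existsNP[i /not_implyP[i_n /negP]]; rewrite -leNgt => abi.
case: n i_n nm ch => // n; rewrite ltnS => i_n nm ch.
have ch2 : boundary_chain z z' n (a \o bump i.+1) (b \o bump i).
  case: ch => a0 bn ab; split; rewrite //= /bump; first by rewrite i_n.
  by move=> k kn; rewrite ab ?addnS //; rewrite /= ltnS; lia.
have [n' [a' [b' [ch' red' len']]]] := IH _ _ _ nm ch2.
exists n', a', b'; split=> //; apply: (le_trans len'); rewrite -[leRHS]addr0.
apply: (@ler_sum_merge _ (fun k => cd o (inr (a k)) (inr (b k)))
  (fun k => cd o (inr (a (bump i.+1 k))) (inr (b (bump i k)))) 0 _ i) => //.
- move=> k ki; have -> : bump i.+1 k = k by rewrite /bump; lia.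
  by have -> : bump i k = k by rewrite /bump; lia.
- by move=> k ki _; rewrite /bump ki ltnW.
rewrite /bump leqnn ltnn add0n add1n.
have := floyd_cdist_triangle hS lam01 (inr (b i)) o (inr (a i)) (inr (b i.+1)).
have := floyd_cdist_triangle hS lam01 (inr (a i.+1)) o (inr (b i)) (inr (b i.+1)).
lra.
Qed.

Variables (PP : set (set G)) (eps : R).

Hypothesis fibre_joint : forall z z', F z = F z' -> 0 < cd o (inr z) (inr z') ->
  exists D : nat, forall e, 0 < e -> exists Y u v,
    [/\ PP Y, exists2 y, Y y & (d o y <= D)%N, nbhd S eps Y u, nbhd S eps Y v &
        cd o (inl u) (inr z) < e /\ cd o (inl v) (inr z') < e].

Hypothesis separation : forall z z' (D : nat), F z <> F z' ->
  exists2 e, 0 < e & forall Y u u', PP Y -> (exists2 y, Y y & (d o y <= D)%N) ->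
    nbhd S eps Y u -> nbhd S eps Y u' ->
    cd o (inl u) (inr z) < e -> cd o (inl u') (inr z') < e -> False.

(** The finitely many horospheres meet a common ball, so the separation constants
    of the pairs of distinct fibres make them distinct once their points are
    close enough to the chain. *)
Lemma reduced_chain_horospheres z z' n a b e :
  boundary_chain z z' n a b -> reduced n a b -> 0 < e -> exists Y u v,
  (forall i, (i < n)%N -> [/\ PP (Y i), nbhd S eps (Y i) (u i), nbhd S eps (Y i) (v i),
     cd o (inl (u i)) (inr (b i)) < e & cd o (inl (v i)) (inr (a i.+1)) < e]) /\
  (forall i j, (i < n)%N -> (j < n)%N -> Y i = Y j -> i = j).
Proof.
move=> [_ _ ch] [red1 red2] e0.
have /choice[D DP] : forall i, exists D : nat, (i < n)%N -> forall e, 0 < e ->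
  exists Y u v, [/\ PP Y, exists2 y, Y y & (d o y <= D)%N,
    nbhd S eps Y u, nbhd S eps Y v &
    cd o (inl u) (inr (b i)) < e /\ cd o (inl v) (inr (a i.+1)) < e].
  move=> i; have [i_n|?] := ltnP i n; last by exists 0%N.
  by have [D DP] := fibre_joint (ch i i_n) (red2 i i_n); exists D.
pose Dmax := (\max_(i < n) D i)%N.
have /choice[r rP] : forall t : nat * nat, exists r, 0 < r /\
    ((t.1 < n)%N -> (t.2 < n)%N -> t.1 <> t.2 ->
     forall Y u u', PP Y -> (exists2 y, Y y & (d o y <= Dmax)%N) ->
     nbhd S eps Y u -> nbhd S eps Y u' ->
     cd o (inl u) (inr (b t.1)) < r -> cd o (inl u') (inr (b t.2)) < r -> False).
  move=> [i j] /=; have [[i_n jn ij]|h] := pselect [/\ (i < n)%N, (j < n)%N & i <> j].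
    have [r r0 rP] := separation Dmax (fun E => ij (red1 i j i_n jn E)).
    by exists r; split=> // _ _ _; apply: rP.
  by exists 1; split=> // i_n jn ij; case: h.
pose e' := \big[Num.min/e]_(t : 'I_n * 'I_n) r (val t.1, val t.2).
have e'0 : 0 < e' by apply: lt_bigmin => // t _; case: (rP (val t.1, val t.2)).
have e'e : e' <= e by apply: bigmin_le_id.
have /choice[t tP] : forall i, exists t : set G * G * G, (i < n)%N ->
  [/\ PP t.1.1, exists2 y, t.1.1 y & (d o y <= D i)%N,
    nbhd S eps t.1.1 t.1.2, nbhd S eps t.1.1 t.2 &
    cd o (inl t.1.2) (inr (b i)) < e' /\ cd o (inl t.2) (inr (a i.+1)) < e'].
  move=> i; have [i_n|?] := ltnP i n; last by exists (set0, o, o).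
  by have [Y [u [v h]]] := DP i i_n e' e'0; exists (Y, u, v).
exists (fun i => (t i).1.1), (fun i => (t i).1.2), (fun i => (t i).2); split.
  move=> i /tP[h1 _ h2 h3 [h4 h5]]; split=> //; exact: lt_le_trans e'e.
move=> i j i_n jn Yij; apply: contrapT => ij.
have [h1 [y Yy yD] h2 _ [h3 _]] := tP i i_n; have [_ _ h2' _ [h3' _]] := tP j jn.
have e'r : e' <= r (i, j).
  exact: (bigmin_le e (Ordinal i_n, Ordinal jn)
    (fun t : 'I_n * 'I_n => r (val t.1, val t.2))).
have [_ /(_ i_n jn ij (t i).1.1 (t i).1.2 (t j).1.2 h1)] := rP (i, j).
apply => //=; last 2 first.
- exact: lt_le_trans e'r.
- exact: lt_le_trans e'r.
- exists y => //; apply: leq_trans yD _.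
  exact: (@leq_bigmax _ (fun i : 'I_n => D i) (Ordinal i_n)).
- by rewrite Yij.
Qed.

End Chains.

(** * Tightening paths and generalized paths *)

Lemma leq_bump_succ i k : (bump i k <= k.+1)%N.
Proof. by rewrite /bump; lia. Qed.

Lemma bumpS_neq i k : k.+1 <> i -> bump i k.+1 = (bump i k).+1.
Proof. by rewrite /bump; lia. Qed.

Lemma bump_inj i : injective (bump i).
Proof. by move=> j k; rewrite /bump; lia. Qed.

Section Tightening.
Variables (R : realType) (G : groupType) (S : {fset G}).
Hypothesis hS : symmetric_generating_set S.
Variable lam : R.
Hypothesis lam01 : 0 < lam < 1.
Variables (o : G) (l : R) (N : nat).
Hypotheses (lN : l <= N%:R) (hN : N%:R <= N.+1%:R * lam ^+ (2 * N).+1).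
Implicit Types (x y : G) (p q : epath G).

Local Notation d := (word_dist S).
Local Notation fl := (floyd_length S lam).

Let lam_gt0 : 0 < lam. Proof. by case/andP: lam01. Qed.
Let lamX_gt0 n : 0 < lam ^+ n. Proof. exact: exprn_gt0. Qed.

(** A path violating tightness is shortened, in both lengths, by a geodesic
    between two of its vertices. *)
Lemma tighten x y p : path_between S x y p ->
  exists q, [/\ path_between S x y q, tight S 1 l q & fl o q <= fl o p].
Proof.
have [m] := ubnP (word_length p); elim: m p => // m IH p /ltnSE pm pp.
have [tp|] := pselect (tight S 1 l p); first by exists p.
have ip : is_path S p by case: pp.
have [_ sp tp] := pp.
move=> /not_andP[//|/existsNP[i /existsNP[j /not_implyP[ij /not_implyP[jp]]]]].
move=> /not_implyP[dij nq].
have [p1 [p3 [pE h1 h2 h3 [l1 l2 l3]]]] := path_split ij jp ip.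
have [q qq lq] := geodesic_exists hS (vertex p i) (vertex p j).
have qlt : (word_length q < word_length (subpath p i j))%N.
  rewrite ltn_neqAle {2}lq (word_dist_le hS h2) andbT.
  apply: contra_notN nq => /eqP lpq; apply: (geodesic_quasi hS).
  by apply: (geodesicP h2); rewrite -lpq.
have qN : (word_length q <= N)%N.
  by rewrite -(ler_nat R) lq (le_trans dij).
have spq : source (subpath p i j) = source q by case: qq => _ ->.
have [[is2 _ _] [iq _ _]] := (h2, qq).
have flq := floyd_length_detour hS lam01 o hN is2 iq spq qN qlt.
pose p' := epath_cat p1 (epath_cat q p3).
have p'p : path_between S x y p'.
  by rewrite -sp -tp; apply: path_between_cat h1 (path_between_cat qq h3).
have flp : fl o p' <= fl o p.
  rewrite [in leRHS]pE (floyd_length_between _ _ h1 (path_between_cat h2 h3)).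
  rewrite (floyd_length_between _ _ h1 (path_between_cat qq h3)) lerD2l.
  by rewrite (floyd_length_between _ _ h2 h3) (floyd_length_between _ _ qq h3) lerD2r.
have lt_m : (word_length p' < m)%N.
  apply: leq_trans pm; rewrite !word_length_cat l1 l3; rewrite l2 in qlt.
  by move: qlt ij jp; clear; lia.
have [r [r1 r2 r3]] := IH p' lt_m p'p.
by exists r; split=> //; apply: le_trans flp.
Qed.

(** The two paths are cut at [x] and [y] and joined by a geodesic. If the first
    path is left at a vertex far from [o], the geodesic has Floyd length at most
    [tau]; otherwise it replaces a long end of this path. *)
Lemma merge_paths (M : nat) (tau : R) p q x y : 
  N%:R * lam ^+ M <= tau * lam ^+ N ->
  is_path S p -> is_path S q -> x \in vertices p -> y \in vertices q ->
  (d x y <= N)%N -> (M + N <= d o (target p))%N -> 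
  exists2 r, path_between S (source p) (target q) r &
    fl o r <= fl o p + fl o q + tau.
Proof.
move=> hM ip iq /(nthP (source p))[i ip' xE] /(nthP (source q))[j jq' yE] xyN far.
rewrite /= ltnS -/(word_length p) in ip'; rewrite -/(vertex p i) in xE.
rewrite /= ltnS -/(word_length q) in jq'; rewrite -/(vertex q j) in yE.
have [p1 [p3 [pE h1 h2 h3 [l1 l2 l3]]]] := path_split ip' (leqnn _) ip.
have [q1 [q3 [qE k1 k2 k3 [m1 m2 m3]]]] := path_split jq' (leqnn _) iq.
have [g gg lg] := geodesic_exists hS x y.
rewrite vertex_last in h2 h3; rewrite vertex_last in k2 k3; set p2 := subpath _ _ _ in pE h2 l2.
set q2 := subpath _ _ _ in qE k2 m2.
rewrite xE in h1 h2; rewrite yE in k1 k2.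
have flp : fl o p = fl o p1 + (fl o p2 + fl o p3).
  rewrite {1}pE (floyd_length_between _ _ h1 (path_between_cat h2 h3)).
  by rewrite (floyd_length_between _ _ h2 h3).
have flq : fl o q = fl o q1 + (fl o q2 + fl o q3).
  rewrite {1}qE (floyd_length_between _ _ k1 (path_between_cat k2 k3)).
  by rewrite (floyd_length_between _ _ k2 k3).
have p30 := floyd_length_ge0 S lam01 o p3; have q10 := floyd_length_ge0 S lam01 o q1.
have q30 := floyd_length_ge0 S lam01 o q3; have p20 := floyd_length_ge0 S lam01 o p2.
have tau0 : 0 <= tau.
  rewrite -(ler_pM2r (lamX_gt0 N)) mul0r; apply: le_trans hM.
  by rewrite mulr_ge0 // ltW.
have flg : fl o g <= fl o p2 + tau.
  have [xM|xM] := leqP M (d o x).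
    suff : fl o g <= tau by lra.
    rewrite -(ler_pM2r (lamX_gt0 N)); apply: le_trans hM.
    apply: (@le_trans _ _ ((word_length g)%:R * lam ^+ M)); last first.
      by rewrite ler_wpM2r ?ler_nat ?lg // ltW.
    apply: (floyd_length_le lam01) => v /(nthP (source g))[k kg vE].
    rewrite /= ltnS -/(word_length g) in kg; rewrite -/(vertex g k) in vE.
    have := geodesic_vertex_dist hS (geodesicP gg lg) (leq0n k) kg.
    rewrite vertex0 vE; have [_ -> _] := gg.
    have := word_dist_triangle hS v o x; rewrite (word_distC hS v).
    by move: kg xyN xM; rewrite lg; clear; lia.
  suff : fl o g <= fl o p2 by lra.
  have gN : (word_length g <= N)%N by rewrite lg.
  have [[ip2 _ _] [ig _ _]] := (h2, gg).
  apply: (floyd_length_detour hS lam01 o hN ip2 ig _ gN).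
    by case: h2 => _ -> _; case: gg.
  rewrite lg; move: xyN xM far (word_dist_le hS h2) (word_dist_triangle hS x o (target p)).
  by clear; lia.
exists (epath_cat p1 (epath_cat g q2)).
  exact: path_between_cat h1 (path_between_cat gg k2).
rewrite (floyd_length_between _ _ h1 (path_between_cat gg k2)).
by rewrite (floyd_length_between _ _ gg k2) flp flq; lra.
Qed.

Lemma entry_point_mem (A : set G) p : entry_point A p \in vertices p.
Proof.
rewrite /entry_point; case: (ltnP (find (fun x => `[< A x >]) (vertices p)) (size (vertices p))).
  exact: mem_nth.
by rewrite /vertex => h; rewrite nth_default // mem_head.
Qed.

Lemma exit_point_mem (A : set G) p : exit_point A p \in vertices p.
Proof.
rewrite /exit_point -mem_rev; case: (ltnP (find (fun x => `[< A x >]) (rev (vertices p)))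
   (size (rev (vertices p)))); first exact: mem_nth.
by move=> h; rewrite nth_default // mem_rev mem_head.
Qed.

Variables (eps : R) (J : set G -> G -> G -> Prop) (M : nat) (tau : R).
Hypothesis J_far : forall Y u v, J Y u v -> (M + N <= d o u)%N.
Hypothesis tauM : N%:R * lam ^+ M <= tau * lam ^+ N.

(** Generalized paths before tightening. The condition [J] on the jumps is
    abstract: tightening deletes jumps and keeps the others as they are. *)
Definition jumping_paths x y (m : nat) (gam : nat -> epath G) (Y : nat -> set G) :=
  [/\ forall k, (k <= m)%N -> is_path S (gam k),
      source (gam 0%N) = x, target (gam m) = y,
      forall k, (k < m)%N -> J (Y k) (target (gam k)) (source (gam k.+1)) &
      forall i j, (i < m)%N -> (j < m)%N -> Y i = Y j -> i = j].

(** Induction on the number of jumps: after all paths have been tightened, either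
    all jumps are long enough, or one of them can be merged away at cost
    [tau]. *)
Lemma jumping_paths_tighten x y m gam Y : jumping_paths x y m gam Y ->
  exists m' gam' Y', [/\ (m' <= m)%N, jumping_paths x y m' gam' Y',
    forall k, (k <= m')%N -> tight S 1 l (gam' k),
    forall k, (k < m')%N -> l <= (d (entry_point (nbhd S eps (Y' k)) (gam' k))
      (exit_point (nbhd S eps (Y' k)) (gam' k.+1)))%:R &
    \sum_(k < m'.+1) fl o (gam' k) <= \sum_(k < m.+1) fl o (gam k) + m%:R * tau].
Proof.
have tau0 : 0 <= tau.
  rewrite -(ler_pM2r (lamX_gt0 N)) mul0r; apply: le_trans tauM.
  by rewrite mulr_ge0 // ltW.
elim: m gam Y => [|m IH] gam Y [paths sx ty jumps inj].
  have p0 : path_between S x y (gam 0%N) by split=> //; apply: paths.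
  have [q [qq tq flq]] := tighten p0.
  exists 0%N, (fun=> q), Y; split=> //.
  - by case: qq => iq sq tq'; split.
  - by rewrite !big_ord1 mul0r addr0.
have /choice[g gP] : forall k, exists q, (k <= m.+1)%N ->
    [/\ path_between S (source (gam k)) (target (gam k)) q, tight S 1 l q &
        fl o q <= fl o (gam k)].
  move=> k; have [km|?] := leqP k m.+1; last by exists (gam k).
  have pk : path_between S (source (gam k)) (target (gam k)) (gam k).
    by split=> //; apply: paths.
  by have [q h] := tighten pk; exists q.
have gs k : (k <= m.+1)%N -> source (g k) = source (gam k) by move=> /gP[[]].
have gt k : (k <= m.+1)%N -> target (g k) = target (gam k) by move=> /gP[[]].
have flg : \sum_(k < m.+2) fl o (g k) <= \sum_(k < m.+2) fl o (gam k).
  by apply: ler_sum => k _; case: (gP k (ltnSE (ltn_ord k))).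
have [ok|/existsNP[i /not_implyP[im /negP]]] := pselect (forall k, (k < m.+1)%N ->
    l <= (d (entry_point (nbhd S eps (Y k)) (g k))
      (exit_point (nbhd S eps (Y k)) (g k.+1)))%:R).
  exists m.+1, g, Y; split=> //.
  - split=> //; rewrite ?gs ?gt //; first by move=> k /gP[[]].
    by move=> k km; rewrite gs // gt //; [exact: jumps | exact: ltnW].
  - by move=> k /gP[].
  - by apply: (le_trans flg); rewrite lerDl mulr_ge0.
rewrite -ltNge => /lt_le_trans/(_ lN)/ltW; rewrite ler_nat => dN.
have im1 : (i <= m.+1)%N by exact: ltnW.
have far : (M + N <= d o (target (g i)))%N by rewrite gt //; apply: J_far (jumps i im).
have [[ig _ _] _ _] := gP i im1; have [[ig' _ _] _ _] := gP i.+1 im.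
have [r [ir sr tr] flr] := merge_paths tauM ig ig' (entry_point_mem _ _)
  (exit_point_mem _ _) dN far.
(* With the paths [i] and [i.+1] merged, the jump [k] is the old jump
   [bump i k]. *)
pose g' k := if k == i then r else g (bump i k).
have g's k : (k < m)%N -> source (g' k.+1) = source (gam (bump i k).+1).
  move=> km; rewrite /g'; case: eqP => [ki|ki].
    by rewrite sr -ki gs ?ki // /bump -ki ltnn.
  by rewrite bumpS_neq // gs // ltnS (leq_trans (leq_bump_succ _ _)).
have g't k : (k <= m)%N -> target (g' k) = target (gam (bump i k)).
  move=> km; rewrite /g'; case: eqP => [->|ki].
    by rewrite tr gt // /bump leqnn.
  by rewrite gt // (leq_trans (leq_bump_succ _ _)).
have ch' : jumping_paths x y m g' (Y \o bump i).
  split.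
  - move=> k km; rewrite /g'; case: eqP => // _.
    by case: (gP (bump i k)) => [|[]] //; rewrite (leq_trans (leq_bump_succ _ _)).
  - rewrite /g' /bump; case: eqP => [iE|/eqP]; first by rewrite sr -iE gs.
    by rewrite eq_sym -lt0n => i0; rewrite leqNgt i0 gs.
  - by rewrite g't // /bump -ltnS im.
  - move=> k km; rewrite g's // g't ?(ltnW km) //; apply: (jumps (bump i k)).
    by rewrite ltnS (leq_trans (leq_bump_succ _ _)).
  - move=> j k jm km /inj h; apply: (@bump_inj i); apply: h.
      by rewrite ltnS (leq_trans (leq_bump_succ _ _)).
    by rewrite ltnS (leq_trans (leq_bump_succ _ _)).
have [m' [gam' [Y' [m'm ch2 tg sep len]]]] := IH _ _ ch'.
exists m', gam', Y'; split=> //; first exact: leqW.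
apply: (le_trans len); rewrite -natr1 mulrDl mul1r [m%:R * _ + _]addrC addrA lerD2r.
apply: le_trans (lerD flg (lexx tau)).
apply: (@ler_sum_merge _ (fun k => fl o (g k)) (fun k => fl o (g' k)) tau m i).
- by rewrite -ltnS.
- by move=> k ki; rewrite /g' ltn_eqF // /bump leqNgt ki.
- by move=> k ki km; rewrite /g' gtn_eqF // /bump ltnW.
- by rewrite /g' eqxx.
Qed.

End Tightening.

(** * Realizing the shortcut distance *)

Section Realization.
Variables (R : realType) (G : groupType) (S : {fset G}).
Hypothesis hS : symmetric_generating_set S.
Variable lam : R.
Hypothesis lam01 : 0 < lam < 1.
Variables (X : metricType R) (F : floyd_boundary S lam -> X).
Hypothesis F_surj : forall x, exists z, F z = x.
Variable o : G.

Local Notation d := (word_dist S).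
Local Notation fl := (floyd_length S lam).
Local Notation fd := (floyd_dist S lam).
Local Notation FB := (floyd_boundary S lam).
Local Notation FC := (floyd_completion S lam).
Local Notation cd := (@floyd_cdist R G S lam).

Let lam_gt0 : 0 < lam. Proof. by case/andP: lam01. Qed.
Let lamX_gt0 n : 0 < lam ^+ n. Proof. exact: exprn_gt0. Qed.

Variables (PP : set (set G)) (eps : R).

Hypothesis fibre_joint : forall z z' : FB, F z = F z' -> 0 < cd o (inr z) (inr z') ->
  exists D : nat, forall e, 0 < e -> exists Y u v,
    [/\ PP Y, exists2 y, Y y & (d o y <= D)%N, nbhd S eps Y u, nbhd S eps Y v &
        cd o (inl u) (inr z) < e /\ cd o (inl v) (inr z') < e].

Hypothesis separation : forall (z z' : FB) (D : nat), F z <> F z' ->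
  exists2 e, 0 < e & forall Y u u', PP Y -> (exists2 y, Y y & (d o y <= D)%N) ->
    nbhd S eps Y u -> nbhd S eps Y u' ->
    cd o (inl u) (inr z) < e -> cd o (inl u') (inr z') < e -> False.

Definition near_fibre (c : R) (u v : G) : Prop := exists z z' : FB,
  [/\ F z = F z', cd o (inl u) (inr z) < c & cd o (inl v) (inr z') < c].

(** The paths are the links of a chain between points of the completion: the
    jumps are inside fibres, up to an error of [c] at each end. *)
Lemma shortcut_dist_jumping (c : R) (z z' : FB) (x y : G) m gam Y (J : set G -> G -> G -> Prop) :
  jumping_paths S J x y m gam Y ->
  (forall A u v, J A u v -> near_fibre c u v) ->
  cd o (inl x) (inr z) < c -> cd o (inl y) (inr z') < c ->
  shortcut_dist F o (inr (F z)) (inr (F z')) <=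
    \sum_(k < m.+1) fl o (gam k) + m.+1%:R * (2 * c).
Proof.
move=> [paths sx ty jumps _] Jc xz yz'.
have /choice[t tP] : forall k, exists t : FB * FB, (k < m)%N ->
    [/\ F t.1 = F t.2, cd o (inl (target (gam k))) (inr t.1) < c &
        cd o (inl (source (gam k.+1))) (inr t.2) < c].
  move=> k; have [km|?] := ltnP k m; last by exists (z, z').
  by have [w [w' h]] := Jc _ _ _ (jumps k km); exists (w, w').
pose xi k : FC := inr (if k is j.+1 then (t j).2 else z).
pose eta k : FC := inr (if (k < m)%N then (t k).1 else z').
have ch : chain F m xi eta.
  move=> k km; exists (t k).1, (t k).2.
  by rewrite /eta /xi km; split=> //; case: (tP k km).
have /= := shortcut_dist_le hS lam01 o ch; rewrite ltnn => h.
apply: (le_trans h); rewrite /chain_length mulr_natl -[X in _ *+ X]card_ord -sumr_const.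
rewrite -big_split; apply: ler_sum => k _; have km := ltnSE (ltn_ord k).
have xk : cd o (inl (source (gam k))) (xi k) < c.
  rewrite /xi; case: {+}(nat_of_ord k) km => [_|j jm]; first by rewrite sx.
  by case: (tP j jm).
have yk : cd o (inl (target (gam k))) (eta k) < c.
  rewrite /eta; case: ltngtP km => // [/tP[] //|-> _]; first by rewrite ty.
have gk : cd o (inl (source (gam k))) (inl (target (gam k))) <= fl o (gam k).
  rewrite floyd_cdist_vertex //; apply: floyd_dist_le => //.
  by split=> //; apply: paths.
have h1 := floyd_cdist_triangle hS lam01 (inl (source (gam k))) o (xi k) (eta k).
have h2 := floyd_cdist_triangle hS lam01 (inl (target (gam k))) o
  (inl (source (gam k))) (eta k).
by rewrite (floyd_cdistC hS lam01 o (xi k) (inl _)) in h1; rewrite /=; lra.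
Qed.

Variables (l : R) (N : nat).
Hypotheses (lN : l <= N%:R) (hN : N%:R <= N.+1%:R * lam ^+ (2 * N).+1).

(** The links of a reduced, almost optimal chain are approximated by paths whose
    jumps go along the horospheres of the fibres; tightening them increases the
    Floyd length by a small amount, and the lower bound applies to the result. *)
Lemma shortcut_dist_realized (za zb : FB) (a b : nat -> G) (e : R) (T : nat) :
  represents (inr za : FC) a -> represents (inr zb : FC) b -> 0 < e ->
  exists gam : seq (epath G),
    [/\ generalized_tight S PP eps 1 l gam,
        exists2 k, (T <= k)%N & gen_source gam = a k,
        exists2 k, (T <= k)%N & gen_target gam = b k &
        `|shortcut_dist F o (inr (F za)) (inr (F zb)) - gen_floyd_length S lam o gam| < e].
Proof.
move=> aza bzb e0; have e4 : 0 < e / 4 by lra.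
have [n0 [al0 [be0 [ch0 len0]]]] := boundary_chain_exists hS lam01 F_surj o za zb e4.
have [n [al [be [ch red /le_lt_trans/(_ len0) len]]]] :=
  boundary_chain_reduce hS lam01 o ch0.
have n0R : (0 : R) < n.+1%:R by rewrite ltr0n.
(* Each link of the chain loses at most [c] at either end and [c] for its path,
   each merge loses [c]: in total [4 * n.+1%:R * c], that is [e / 2]. *)
pose c := e / (8 * n.+1%:R).
have c0 : 0 < c by rewrite divr_gt0 // mulr_gt0.
have cE : n.+1%:R * c = e / 8.
  by rewrite /c; move: (n.+1%:R : R) n0R => x x0; field; rewrite gt_eqF.
have N0R : (0 : R) < N.+1%:R by rewrite ltr0n.
(* A path of [N] edges with all vertices within [N] of a vertex at distance [M]
   or more from [o] has Floyd length at most [c]. *)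
have [M _ /(_ M (leqnn M)) /= hM] :=
  lamX_cvg0 lam01 (divr_gt0 (mulr_gt0 c0 (lamX_gt0 N)) N0R).
have cM : N%:R * lam ^+ M <= c * lam ^+ N.
  rewrite ltr_pdivlMr // mulrC in hM; apply: le_trans (ltW hM).
  by rewrite ler_wpM2r ?ler_nat // ltW.
have c'0 : 0 < Num.min c (lam ^+ (M + N)) by rewrite lt_min c0 lamX_gt0.
have [Y [u [v [uv Yinj]]]] :=
  reduced_chain_horospheres fibre_joint separation ch red c'0.
have [k1 Tk1 ak1] : exists2 k, (T <= k)%N & cd o (inl (a k)) (inr za) < c.
  near \oo => k; exists k; first by near: k; apply: nbhs_infty_ge.
  by near: k; apply: (represents_cvg hS lam01).
have [k2 Tk2 bk2] : exists2 k, (T <= k)%N & cd o (inl (b k)) (inr zb) < c.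
  near \oo => k; exists k; first by near: k; apply: nbhs_infty_ge.
  by near: k; apply: (represents_cvg hS lam01).
have [al_0 be_n _] := ch.
pose src k := if k is j.+1 then v j else a k1.
pose tgt k := if (k < n)%N then u k else b k2.
have srcP k : (k <= n)%N -> cd o (inl (src k)) (inr (al k)) < c.
  case: k => [|j] jn /=; first by rewrite al_0.
  by have [_ _ _ _] := uv j jn; rewrite lt_min => /andP[].
have tgtP k : (k <= n)%N -> cd o (inl (tgt k)) (inr (be k)) < c.
  rewrite /tgt; case: ltngtP => // [kn _|-> _]; last by rewrite be_n.
  by have [_ _ _] := uv k kn; rewrite lt_min => /andP[].
have /choice[gam gamP] : forall k, exists p, path_between S (src k) (tgt k) p /\
    fl o p < fd o (src k) (tgt k) + c.
  by move=> k; have [p pp flp] := floyd_dist_path hS lam01 o (src k) (tgt k) c0; exists p.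
pose J A x y := [/\ PP A, nbhd S eps A x, nbhd S eps A y, (M + N <= d o x)%N & near_fibre c x y].
have jump : jumping_paths S J (a k1) (b k2) n gam Y.
  split=> //.
  - by move=> k _; case: (gamP k) => -[].
  - by case: (gamP 0%N) => -[].
  - by case: (gamP n) => -[_ _ ->]; rewrite /tgt ltnn.
  - move=> k kn; case: (gamP k) => -[_ _ ->] _; case: (gamP k.+1) => -[_ -> _] _.
    rewrite /tgt kn /=; have [h1 h2 h3] := uv k kn.
    rewrite !lt_min => /andP[h4 h5] /andP[h6 _]; split=> //.
      exact: (boundary_far hS lam01 h5).
    by exists (be k), (al k.+1); split=> //; case: ch => _ _; apply.
have J_far A x y : J A x y -> (M + N <= d o x)%N by case.
have [m [gam' [Y' [mn [paths s' t' jumps inj'] tg sep len']]]] :=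
  jumping_paths_tighten hS lam01 lN hN eps J_far cM jump.
have nthE k : (k <= m)%N -> path_nth (mkseq gam' m.+1) k = gam' k.
  by move=> km; rewrite /path_nth nth_mkseq.
exists (mkseq gam' m.+1); split.
- split; rewrite ?size_mkseq //.
    by move=> p /mapP[k]; rewrite mem_iota add0n ltnS => /tg ? ->.
  exists Y'; split=> [k km|j k jm km|k km].
  + by case: (jumps k km).
  + exact: inj'.
  + rewrite !nthE // 1?ltnW //; case: (jumps k km) => _ h1 h2 _ _; split=> //.
    exact: sep.
- by exists k1 => //; rewrite /gen_source nthE.
- by exists k2 => //; rewrite /gen_target size_mkseq nthE.
have -> : gen_floyd_length S lam o (mkseq gam' m.+1) = \sum_(k < m.+1) fl o (gam' k).
  by rewrite /gen_floyd_length big_map -[iota _ _]/(index_iota 0 m.+1) big_mkord.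
have lower := @shortcut_dist_jumping c za zb _ _ m gam' Y' J
  (And5 paths s' t' jumps inj') (fun A x y h => let: And5 _ _ _ _ q := h in q) ak1 bk2.
have upper : \sum_(k < n.+1) fl o (gam k) <= boundary_length o n al be + n.+1%:R * (3 * c).
  rewrite mulr_natl -[X in _ *+ X]card_ord -sumr_const -big_split.
  apply: ler_sum => k _; have kn := ltnSE (ltn_ord k) => /=.
  have [_ flk] := gamP k; have h1 := srcP k kn; have h2 := tgtP k kn.
  rewrite -(floyd_cdist_vertex hS lam01) in flk.
  have h3 := floyd_cdist_triangle hS lam01 (inr (al k)) o (inl (src k)) (inl (tgt k)).
  have h4 := floyd_cdist_triangle hS lam01 (inr (be k)) o (inr (al k)) (inl (tgt k)).
  by rewrite (floyd_cdistC hS lam01 o (inr (be k))) in h4; lra.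
have mc : m.+1%:R * c <= n.+1%:R * c by rewrite ler_pM2r // ler_nat.
have nc : n%:R * c <= n.+1%:R * c by rewrite ler_pM2r // ler_nat.
by rewrite ltr_distl; apply/andP; split; lra.
Unshelve. all: by end_near.
Qed.

End Realization.

(** By Bernoulli's inequality. *)
Lemma detour_rate_exists (R : realType) (N : nat) (lam1 : R) : 0 < lam1 < 1 ->
  exists lam0 : R, [/\ 0 < lam0, lam1 <= lam0, lam0 < 1 &
    forall lam, lam0 <= lam < 1 -> N%:R <= N.+1%:R * lam ^+ (2 * N).+1].
Proof.
case/andP => l0 l1; pose k := (2 * N).+1.
have k0 : (0 : R) < (k * N.+1)%:R by rewrite ltr0n.
have ki0 : 0 < (k * N.+1)%:R^-1 :> R by rewrite invr_gt0.
exists (Num.max lam1 (1 - (k * N.+1)%:R^-1)); split.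
- by rewrite lt_max l0.
- by rewrite le_max lexx.
- by rewrite gt_max l1 ltrBlDr ltrDl.
move=> lam; rewrite ge_max => /andP[/andP[h1 h2] h3].
have bern m : 1 - m%:R * (1 - lam) <= lam ^+ m.
  elim: m => [|m IH]; first by rewrite mul0r subr0.
  have m0 : (0 : R) <= m%:R by [].
  rewrite exprS; apply: le_trans (ler_wpM2l _ IH); last lra.
  rewrite -subr_ge0 -natr1.
  rewrite [leRHS](_ : _ = m%:R * (1 - lam) ^+ 2); last ring.
  by rewrite mulr_ge0 ?sqr_ge0.
apply: (@le_trans _ _ (N.+1%:R * (1 - k%:R * (1 - lam)))); last first.
  by rewrite ler_wpM2l.
have : (k * N.+1)%:R * (1 - lam) <= 1.
  by rewrite -ler_pdivlMl // mulr1 lerBlDr -lerBlDl.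
rewrite natrM (_ : N%:R = N.+1%:R - 1); last by rewrite -natr1 addrK.
move=> h; rewrite mulrBr mulr1 lerD2l lerN2 mulrA.
by rewrite [N.+1%:R * _]mulrC.
Qed.

Theorem proposition5p11 (R : realType) (G : groupType) (S : {fset G})
  (hS : symmetric_generating_set S)
  (X : metricType R) (act : G -> X -> X) (hact : geometrically_finite act)
  (Par : set (set G)) (hPar : parabolic_representatives act Par)
  (lam1 : R) (hlam1 : 0 < lam1 < 1)
  (F : forall lam : R, floyd_boundary S lam -> X)
  (hF : forall lam : R, lam1 <= lam < 1 -> floyd_map act (F lam))
  (mu1 D1 : R) (hmu1 : 0 < mu1) (hD1 : 0 < D1)
  (hproj : projection_bound S (parabolic_cosets Par) mu1 D1)
  (eps : R) (heps : mu1 < eps)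
  (hvis : visibility lam1 F (parabolic_cosets Par) eps)
  (hdeep : deepness_bound S (parabolic_cosets Par) eps)
  (o : G) (l : R) (hl : 0 <= l) :
  exists lam0 : R, [/\ 0 < lam0, lam1 <= lam0, lam0 < 1 &
    forall lam : R, lam0 <= lam < 1 ->
    forall xi eta : X, xi <> eta ->
    forall a b : nat -> G,
      geodesic_ray S o a -> ray_ends_at (F lam) a xi ->
      geodesic_ray S o b -> ray_ends_at (F lam) b eta ->
    exists gam : nat -> seq (epath G),
      [/\ forall n, generalized_tight S (parabolic_cosets Par) eps 1 l (gam n),
          forall n, range a (gen_source (gam n)) /\
                    range b (gen_target (gam n)),
          word_dist S o (gen_source (gam n)) @[n --> \oo] --> \oo,
          word_dist S o (gen_target (gam n)) @[n --> \oo] --> \oo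
        & gen_floyd_length S lam o (gam n) @[n --> \oo] -->
            shortcut_dist (F lam) o (inr xi) (inr eta)]].
Proof.
have [[X_compact act_homeo _] _ nofix _] := hact.
have [Par_stab _] := hPar.
pose N := (Num.truncn l).+1.
have lN : l <= N%:R by apply/ltW/truncnS_gt.
have [lam0 [lam0_gt0 lam10 lam0_lt1 rate]] := detour_rate_exists N hlam1.
exists lam0; split=> // lam lam0P xi eta xi_eta a b [a0 ag] [za aza zaE] [b0 bg] [zb bzb zbE].
have lamP : lam1 <= lam < 1 by case/andP: lam0P => h1 ->; rewrite (le_trans lam10).
have lam01 : 0 < lam < 1.
  by case/andP: lam0P => h1 ->; rewrite (lt_le_trans lam0_gt0).
have hFl := hF lam lamP; have [_ _ F_surj] := hFl.
have proper x : bounded_parabolic act x -> proper_stabilizer act x by case.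
have sep (z z' : floyd_boundary S lam) (D : nat) : F lam z <> F lam z' ->
  exists2 e : R, 0 < e & forall Y u u', parabolic_cosets Par Y ->
    (exists2 y, Y y & (word_dist S o y <= D)%N) ->
    nbhd S eps Y u -> nbhd S eps Y u' ->
    floyd_cdist o (inl u) (inr z) < e -> floyd_cdist o (inl u') (inr z') < e -> False.
  move=> zz'; have [[q qpar]|nopar] := pselect (exists q, bounded_parabolic act q).
    have third := parabolic_third_point act_homeo nofix qpar.
    have [e e0 he] :=
      coset_not_near_both hS lam01 X_compact act_homeo hFl third o eps D zz'.
    exists e => // Y u u' [g [P [/Par_stab[x xpar ->] ->]]] [y Yy yD].
    exact: (he g x u u' y (proper x xpar) Yy yD).
  exists 1 => // Y u u' [g [P [/Par_stab[x xpar _] _]]].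
  by case: nopar; exists x.
have vis r : 0 < r -> exists2 kappa, 0 < kappa &
  forall (p : epath G) (v : G), geodesic S p -> (0 < word_length p)%N ->
    transition_point S (parabolic_cosets Par) eps r p v ->
    kappa < shortcut_dist (F lam) v (inl (source p)) (inl (target p)).
  by move=> r0; apply: hvis.
have joint := fibre_horosphere hS lam01 (o := o) vis.
have /choice[gam gamP] : forall n : nat, exists gam : seq (epath G),
    [/\ generalized_tight S (parabolic_cosets Par) eps 1 l gam,
        exists2 k, (n <= k)%N & gen_source gam = a k,
        exists2 k, (n <= k)%N & gen_target gam = b k &
        `|shortcut_dist (F lam) o (inr (F lam za)) (inr (F lam zb)) -
          gen_floyd_length S lam o gam| < n.+1%:R^-1].
  move=> n; apply: (shortcut_dist_realized hS lam01 F_surj joint sep lN (rate _ lam0P)).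
  - exact/represents_boundary.
  - exact/represents_boundary.
  - by rewrite invr_gt0.
exists gam; split.
- by move=> n; case: (gamP n).
- by move=> n; case: (gamP n) => _ [k _ ->] [k' _ ->] _; split; [exists k|exists k'].
- apply/cvgnyPge => M; exists M => // n /= Mn.
  case: (gamP n) => _ [k nk ->] _ _.
  by rewrite -{1}a0 ag // subn0 (leq_trans Mn).
- apply/cvgnyPge => M; exists M => // n /= Mn.
  case: (gamP n) => _ _ [k nk ->] _.
  by rewrite -{1}b0 bg // subn0 (leq_trans Mn).
- apply/cvgrPdist_lt => e e0.
  apply: filterS (near_infty_natSinv_lt (PosNum e0)) => n /=; apply: lt_trans.
  by rewrite -zaE -zbE; case: (gamP n).
Qed.
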